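(* Let $A$ be a standard graded artinian $k$-algebra of socle degree $D$, where $k$ is a field of characteristic zero, and let $h_i=\dim_k A_i$. Then the following are equivalent. (a) $A$ is almost centered and has the SLP. (b) $A$ has the SLP and a Hilbert series satisfying that $h_{i-1}\leq h_{D-i}\leq h_i$ for all $0\leq i\leq\lfloor\frac{D}{2}\rfloor$, or $h_{D-i+1}\leq h_i\leq h_{D-i}$ for all $0\leq i\leq\lfloor\frac{D}{2}\rfloor$. (c) $A\otimes_k k[x]/(x^d)$ has the SLP for all $d\geq 1$. (d) $A\otimes_k k[x_1,\dots,x_n]/(x_1^{d_1},\dots,x_n^{d_n})$ has the SLP for all $d_1,\dots,d_n\geq 1$. (e) $A\otimes_k k[x_1,\dots,x_n]/(x_1^2,\dots,x_n^2)$ has the WLP for all $n\geq 0$.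
   Context: A standard graded artinian $k$-algebra is a finite-dimensional quotient of a polynomial ring over $k$ (all variables of degree $1$) by a homogeneous ideal; its socle degree $D$ is the largest degree with $A_D\neq0$. We set $h_i=0$ for $i<0$ and $i>D$. The variables $x,x_1,\dots,x_n$ are new variables of degree $1$; in (d), $n\geq 1$ is any number of variables. A linear map has full rank if it is injective or surjective. $A$ has the weak Lefschetz property (WLP) if there is $\ell\in A_1$ such that $\cdot\ell:A_i\to A_{i+1}$ has full rank for every $i$; it has the strong Lefschetz property (SLP) if there is $\ell\in A_1$ such that $\cdot\ell^t:A_i\to A_{i+t}$ has full rank for all $i\geq 0$, $t\geq 1$. $A$ is almost centered if both: (1) if $h_i<h_j$ for some $i<j$, then $h_{i-s}\leq h_{j+s}$ for any $s\geq 0$; (2) if $h_i>h_j$ for some $i<j$, then $h_{i-s}\geq h_{j+s}$ for any $s\geq 0$. *)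

(* Defs.v *)
From HB Require Import structures.
From mathcomp Require Import all_boot all_order all_algebra all_field.
From mathcomp Require Import mpoly.

Set Implicit Arguments.
Unset Strict Implicit.
Unset Printing Implicit Defensive.

Import Order.TTheory GRing.Theory Num.Theory.

Local Open Scope ring_scope.

Record gradedAlg (k : fieldType) := GradedAlg {
  galg :> falgType k;
  gcomp : nat -> {vspace galg};
  gcomp1 : 1 \in gcomp 0;
  gcompM : forall i j, (gcomp i * gcomp j <= gcomp (i + j))%VS;
  gcomp_direct : forall N, directv (\sum_(i < N) gcomp i);
  gcomp_full : exists N, (\sum_(i < N) gcomp i)%VS = fullv }.

Arguments gcomp {k} A i : rename.

Section Presentation.

Variables (k : fieldType) (B : falgType k) (n : nat).
Variable (rho : {lrmorphism {mpoly k[n]} -> B}).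

(* The image under rho of the space of forms of degree i (image_compP). *)
Definition image_comp (i : nat) : {vspace B} :=
  (\sum_(m : 'X_{1..n < i.+1} | mdeg m == i) <[rho 'X_[m]]>)%VS.

Definition homogeneous_kernel : Prop :=
  forall p, rho p = 0 -> forall i, rho (pihomog mdeg i p) = 0.

Lemma image_compP i b :
  reflect (exists2 p, p \is i.-homog & b = rho p) (b \in image_comp i).
Proof.
apply: (iffP idP) => [/memv_sumP[us us_in ->]|[p ph ->]].
  have /fin_all_exists [p pP] (m : 'X_{1..n < i.+1}) :
      exists q : {mpoly k[n]}, mdeg m == i -> q \is i.-homog /\ us m = rho q.
    case: (boolP (mdeg m == i)) => [mi|_]; last by exists 0.
    have /vlineP [c ->] := us_in m mi; exists (c *: 'X_[m]) => _.
    by rewrite linearZ rpredZ // dhomogX.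
  exists (\sum_(m : 'X_{1..n < i.+1} | mdeg m == i) p m).
    by apply: rpred_sum => m /pP[].
  by rewrite rmorph_sum; apply: eq_bigr => m /pP[].
rewrite [p]mpolyE rmorph_sum big_seq; apply: memv_suml => m mp.
have mi : mdeg m = i by apply: (dhomog_mf ph).
have mlt : (mdeg m < i.+1)%N by rewrite mi.
rewrite /= linearZ memvZ // /image_comp memvE.
by rewrite (sumv_sup (BMultinom mlt)) //= mi.
Qed.

Hypothesis rho_surj : forall b, exists p, rho p = b.
Hypothesis rho_ker : homogeneous_kernel.

Fact image_comp1 : 1 \in image_comp 0.
Proof. by apply/image_compP; exists 1; rewrite ?rmorph1 // dhomog1. Qed.

Fact image_compM i j : (image_comp i * image_comp j <= image_comp (i + j))%VS.
Proof.
apply/prodvP => _ _ /image_compP[p ph ->] /image_compP[q qh ->].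
by apply/image_compP; exists (p * q); rewrite ?rmorphM // dhomogM.
Qed.

(* Stated for an abstract G, as directv looks inside the body of image_comp. *)
Fact image_comp_direct_subdef (G : nat -> {vspace B}) N :
  G =1 image_comp -> directv (\sum_(i < N) G i).
Proof.
move=> GE; apply/(@directv_sum_independent _ _ _ _ (fun i : 'I_N => G i)).
move=> us us_in us0 i _.
have /fin_all_exists [p pP] (j : 'I_N) : exists q : {mpoly k[n]},
    q \is j.-homog /\ us j = rho q.
  by have := us_in j isT; rewrite GE => /image_compP[q]; exists q.
rewrite (pP i).2.
have -> : p i = pihomog mdeg i (\sum_j p j).
  rewrite linear_sum (bigD1 i) //= pihomog_dE ?(pP i).1 // big1 ?addr0 // => j ji.
  by apply: pihomog_ne0 (pP j).1; rewrite eq_sym in ji *; apply: contra ji => /eqP/val_inj->.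
apply: rho_ker; rewrite rmorph_sum -[RHS]us0.
by apply: eq_bigr => j _; rewrite (pP j).2.
Qed.

Fact image_comp_full : exists N, (\sum_(i < N) image_comp i)%VS = fullv.
Proof.
have [N HN] : exists N, forall b, b \in (\sum_(i < N) image_comp i)%VS.
  have /fin_all_exists [p pP] (j : 'I_(\dim {:B})) : exists q, rho q = (vbasis {:B})`_j.
    exact: rho_surj.
  exists (\max_j msize (p j)) => b.
  rewrite [b](coord_vbasis (memvf b)); apply: memv_suml => j _.
  rewrite memvZ // -pP [p j](@pihomog_partitionE _ _ mdeg (\max_j msize (p j))); last exact: leq_bigmax.
  rewrite rmorph_sum; apply: memv_sumr => i _.
  by apply/image_compP; exists (pihomog mdeg i (p j)); rewrite ?pihomogP.
by exists N; apply/vspaceP => b; rewrite HN memvf.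
Qed.

Definition presented_alg : gradedAlg k :=
  GradedAlg image_comp1 image_compM
    (fun N => image_comp_direct_subdef N (frefl image_comp)) image_comp_full.

End Presentation.

(* By the first isomorphism theorem: A is a quotient of a polynomial ring by  *)
(* a homogeneous ideal, graded by the degree of polynomials; finite dimension *)
(* is part of falgType.                                                       *)
Definition standard_graded (k : fieldType) (A : gradedAlg k) : Prop :=
  exists (m : nat) (pi : {lrmorphism {mpoly k[m]} -> A}),
    [/\ forall a, exists p, pi p = a,
        homogeneous_kernel pi
      & forall i, gcomp A i = image_comp pi i].

(* The tensor product of A and B, in coordinates: M stands for the sum of the *)
(* M i j *: (e_i (x) f_j), with e, f the canonical bases of A and B.          *)
Definition tensor_type (k : fieldType) (A B : falgType k) : Type :=
  'M[k]_(\dim {:A}, \dim {:B}).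

Section Tensor.

Variables (k : fieldType) (A B : falgType k).
Local Notation T := (tensor_type A B).
Local Notation e := (vbasis {:A}).
Local Notation f := (vbasis {:B}).

HB.instance Definition _ := Vector.on T.

Definition tens (a : A) (b : B) : T :=
  \matrix_(i, j) (coord e i a * coord f j b).

Definition bilin (C : lmodType k) (phi : A -> B -> C) : Prop :=
  (forall b, linear (phi^~ b)) /\ (forall a, linear (phi a)).

(* The linear map on T induced by phi; see tens_liftE and tens_lift_uniq.     *)
Definition tens_lift (C : lmodType k) (phi : A -> B -> C) (M : T) : C :=
  \sum_i \sum_j M i j *: phi e`_i f`_j.

Definition tensor_one : T := tens 1 1.

Definition tensor_mul (M N : T) : T :=
  tens_lift (fun a b => tens_lift (fun a' b' => tens (a * a') (b * b')) N) M.

Lemma tens_bilin : bilin tens.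
Proof.
split=> [b|a] c u v; apply/matrixP => i j; rewrite !mxE linearP.
  by rewrite mulrDl mulrA.
by rewrite mulrDr mulrCA.
Qed.

Lemma tensP c a a' b : tens (c *: a + a') b = c *: tens a b + tens a' b.
Proof. exact: tens_bilin.1. Qed.

Lemma tensPr c a b b' : tens a (c *: b + b') = c *: tens a b + tens a b'.
Proof. exact: tens_bilin.2. Qed.

Fact tens_lift_linear (C : lmodType k) (phi : A -> B -> C) :
  linear (tens_lift phi).
Proof.
move=> c M N; rewrite /tens_lift scaler_sumr -big_split; apply: eq_bigr => i _.
rewrite scaler_sumr -big_split; apply: eq_bigr => j _.
by rewrite !mxE scalerDl scalerA.
Qed.

HB.instance Definition _ (C : lmodType k) (phi : A -> B -> C) :=
  GRing.isLinear.Build k T C _ (tens_lift phi) (@tens_lift_linear C phi).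

Lemma bilin_sum (C : lmodType k) (phi : A -> B -> C) (I J : finType)
    (x : I -> k) (u : I -> A) (y : J -> k) (v : J -> B) : bilin phi ->
  phi (\sum_i x i *: u i) (\sum_j y j *: v j)
    = \sum_i \sum_j (x i * y j) *: phi (u i) (v j).
Proof.
case=> phil phir.
pose phiL b := HB.pack_for {linear A -> C} (phi^~ b) (GRing.isLinear.Build _ _ _ _ (phi^~ b) (phil b)).
pose phiR a := HB.pack_for {linear B -> C} (phi a) (GRing.isLinear.Build _ _ _ _ (phi a) (phir a)).
rewrite -[phi _ _]/(phiL _ _) linear_sum; apply: eq_bigr => i _.
rewrite linearZ /= -[phi _ _]/(phiR _ _) linear_sum scaler_sumr.
by apply: eq_bigr => j _; rewrite linearZ scalerA.
Qed.

Lemma tens_liftE (C : lmodType k) (phi : A -> B -> C) a b :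
  bilin phi -> tens_lift phi (tens a b) = phi a b.
Proof.
move=> bphi.
rewrite [in RHS](coord_vbasis (memvf a)) [in RHS](coord_vbasis (memvf b)).
rewrite bilin_sum //; apply: eq_bigr => i _; apply: eq_bigr => j _.
by rewrite mxE.
Qed.

Lemma tens_basis (i : 'I_(\dim {:A})) (j : 'I_(\dim {:B})) :
  tens e`_i f`_j = delta_mx i j.
Proof.
apply/matrixP => i' j'; rewrite !mxE.
rewrite !coord_free ?(basis_free (vbasisP _)) //.
by rewrite -natrM mulnb [i == _]eq_sym [j == _]eq_sym.
Qed.

Lemma tens_span (M : T) : M = tens_lift tens M.
Proof.
rewrite {1}[M]matrix_sum_delta; apply: eq_bigr => i _; apply: eq_bigr => j _.
by rewrite tens_basis.
Qed.

Lemma tens_lift_uniq (C : lmodType k) (psi psi' : {linear T -> C}) :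
  (forall a b, psi (tens a b) = psi' (tens a b)) -> psi =1 psi'.
Proof.
move=> psiE M; rewrite [M]tens_span /tens_lift !linear_sum; apply: eq_bigr => i _.
by rewrite !linear_sum; apply: eq_bigr => j _; rewrite !linearZ psiE.
Qed.

Lemma tensor_mulDl M M' N c :
  tensor_mul (c *: M + M') N = c *: tensor_mul M N + tensor_mul M' N.
Proof. exact: linearP. Qed.

Lemma tensor_mulDr M N N' c :
  tensor_mul M (c *: N + N') = c *: tensor_mul M N + tensor_mul M N'.
Proof.
rewrite /tensor_mul {1}/tens_lift.
under eq_bigr do under eq_bigr do rewrite linearP scalerDr scalerA mulrC -scalerA.
rewrite {2 3}/tens_lift scaler_sumr -big_split; apply: eq_bigr => i _.
by rewrite scaler_sumr -big_split.
Qed.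

Lemma tensor_mulE a b a' b' :
  tensor_mul (tens a b) (tens a' b') = tens (a * a') (b * b').
Proof.
pose phi x y : A -> B -> T := fun x' y' => tens (x * x') (y * y').
have phiP x y : bilin (phi x y).
  by split=> [y'|x'] c u v; rewrite /phi mulrDr -scalerAr ?tensP ?tensPr.
rewrite /tensor_mul tens_liftE; first by rewrite -/(phi a b) tens_liftE.
split=> [y|x] c u v; rewrite -!/(phi _ _) !tens_liftE // /phi mulrDl -scalerAl.
  by rewrite tensP.
by rewrite tensPr.
Qed.

Let mulL N := HB.pack_for {linear T -> T} (tensor_mul^~ N)
  (GRing.isLinear.Build _ _ _ _ (tensor_mul^~ N) (fun c M M' => tensor_mulDl M M' N c)).
Let mulR M := HB.pack_for {linear T -> T} (tensor_mul M)
  (GRing.isLinear.Build _ _ _ _ (tensor_mul M) (fun c N N' => tensor_mulDr M N N' c)).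

Fact tensor_mulA : associative tensor_mul.
Proof.
move=> M N P.
apply: (tens_lift_uniq (psi := mulL (mulR N P)) (psi' := mulL P \o mulL N)) => a b /=.
apply: (tens_lift_uniq (psi := mulR (tens a b) \o mulL P)
  (psi' := mulL P \o mulR (tens a b))) => a' b' /=.
apply: (tens_lift_uniq (psi := mulR (tens a b) \o mulR (tens a' b'))
  (psi' := mulR (tensor_mul (tens a b) (tens a' b')))) => a'' b'' /=.
by rewrite !tensor_mulE !mulrA.
Qed.

Fact tensor_mul1 : left_id tensor_one tensor_mul.
Proof.
move=> M; apply: (tens_lift_uniq (psi := mulR tensor_one) (psi' := idfun)) => a b /=.
by rewrite tensor_mulE !mul1r.
Qed.

Fact tensor_mulr1 : right_id tensor_one tensor_mul.
Proof.
move=> M; apply: (tens_lift_uniq (psi := mulL tensor_one) (psi' := idfun)) => a b /=.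
by rewrite tensor_mulE !mulr1.
Qed.

Fact tensor_mul_addl : left_distributive tensor_mul +%R.
Proof. by move=> M N P; apply: (raddfD (mulL P)). Qed.

Fact tensor_mul_addr : right_distributive tensor_mul +%R.
Proof. by move=> M N P; apply: (raddfD (mulR M)). Qed.

Fact tensor_one_neq0 : tensor_one != 0.
Proof.
have H (C : falgType k) : exists i, coord (vbasis {:C}) i 1 != 0.
  apply/existsP; rewrite -negb_forall; apply: contraT; rewrite negbK => /forallP c0.
  case/eqP: (oner_neq0 C); rewrite [LHS](coord_vbasis (memvf _)) big1 // => i _.
  by rewrite (eqP (c0 i)) scale0r.
have [i ei] := H A; have [j fj] := H B.
apply/eqP => /matrixP/(_ i j)/eqP; rewrite !mxE mulf_eq0.
by rewrite (negPf ei) (negPf fj).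
Qed.

HB.instance Definition _ := GRing.Zmodule_isNzRing.Build T
  tensor_mulA tensor_mul1 tensor_mulr1 tensor_mul_addl tensor_mul_addr
  tensor_one_neq0.

Fact tensor_scaleAl c (M N : T) : c *: (M * N) = (c *: M) * N.
Proof. by symmetry; apply: (linearZZ (mulL N)). Qed.

HB.instance Definition _ := GRing.Lmodule_isLalgebra.Build k T tensor_scaleAl.

Fact tensor_scaleAr c (M N : T) : c *: (M * N) = M * (c *: N).
Proof. by symmetry; apply: (linearZZ (mulR M)). Qed.

HB.instance Definition _ := GRing.Lalgebra_isAlgebra.Build k T tensor_scaleAr.
HB.instance Definition _ := Algebra_isFalgebra.Build k T.

Lemma tensM a b a' b' : tens a b * tens a' b' = tens (a * a') (b * b').
Proof. exact: tensor_mulE. Qed.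

End Tensor.

Section TensorSpace.

Variables (k : fieldType) (A B : falgType k).

Definition tensorv (U : {vspace A}) (V : {vspace B}) : {vspace tensor_type A B} :=
  (\sum_(i < \dim U) \sum_(j < \dim V) <[tens (vbasis U)`_i (vbasis V)`_j]>)%VS.

Lemma memv_tens (U : {vspace A}) (V : {vspace B}) a b : a \in U -> b \in V -> tens a b \in tensorv U V.
Proof.
move=> aU bV; rewrite (coord_vbasis aU) (coord_vbasis bV).
rewrite bilin_sum; last exact: tens_bilin.
apply: memv_sumr => i _; apply: memv_sumr => j _.
by rewrite memvZ // memv_line.
Qed.

Lemma tensorv_subP (U : {vspace A}) (V : {vspace B}) (W : {vspace tensor_type A B}) :
  (forall a b, a \in U -> b \in V -> tens a b \in W) -> (tensorv U V <= W)%VS.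
Proof.
move=> H; apply/subv_sumP => i _; apply/subv_sumP => j _.
by rewrite -memvE H // vbasis_mem // mem_nth // size_tuple.
Qed.

Lemma dim_tensorv U V : (\dim (tensorv U V) <= \dim U * \dim V)%N.
Proof.
apply: leq_trans (dimv_leq_sum _ _ _) _.
rewrite -[X in (_ <= X * _)%N]card_ord -sum_nat_const; apply: leq_sum => i _.
apply: leq_trans (dimv_leq_sum _ _ _) _.
rewrite -[X in (_ <= X)%N]card_ord -sum1_card; apply: leq_sum => j _.
by rewrite dim_vline leq_b1.
Qed.

End TensorSpace.

Section TensorGraded.

Variables (k : fieldType) (A B : gradedAlg k).

Definition tensor_comp (i : nat) : {vspace tensor_type A B} :=
  (\sum_(a < i.+1) tensorv (gcomp A a) (gcomp B (i - a)))%VS.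

Lemma mem_tensor_comp i j a b :
  a \in gcomp A i -> b \in gcomp B j -> tens a b \in tensor_comp (i + j).
Proof.
move=> ai bj; have lt : (i < (i + j).+1)%N by rewrite ltnS leq_addr.
rewrite memvE (sumv_sup (Ordinal lt)) //= -memvE memv_tens //.
by rewrite addKn.
Qed.

Lemma tensor_comp_ind i (W : {vspace tensor_type A B}) :
  (forall p q a b, p + q = i -> a \in gcomp A p -> b \in gcomp B q ->
     tens a b \in W)%N -> (tensor_comp i <= W)%VS.
Proof.
move=> H; apply/subv_sumP => p _; apply: tensorv_subP => a b; apply: H.
by rewrite subnKC // -ltnS.
Qed.

Fact tensor_comp1 : 1 \in tensor_comp 0.
Proof. exact: (mem_tensor_comp (gcomp1 A) (gcomp1 B)). Qed.

Fact tensor_compM i j : (tensor_comp i * tensor_comp j <= tensor_comp (i + j))%VS.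
Proof.
apply/prodvP => M N Mi Nj.
have HR : (tensor_comp j <= (amull M) @^-1: tensor_comp (i + j))%VS.
  apply: tensor_comp_ind => p q a b pq ap bq; rewrite -memv_preim lfunE /=.
  have HL : (tensor_comp i <= (amulr (tens a b : tensor_type A B)) @^-1: tensor_comp (i + j))%VS.
    apply: tensor_comp_ind => p' q' a' b' pq' ap' bq'; rewrite -memv_preim lfunE /=.
    rewrite tensM -pq -pq' addnACA mem_tensor_comp //.
      by apply: (subvP (gcompM A _ _)); rewrite memv_mul.
    by apply: (subvP (gcompM B _ _)); rewrite memv_mul.
  by move/subvP: HL => /(_ M Mi); rewrite -memv_preim lfunE.
by move/subvP: HR => /(_ N Nj); rewrite -memv_preim lfunE.
Qed.

Fact tensor_comp_full : exists N0, forall N, (N0 <= N)%N ->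
  (\sum_(i < N) tensor_comp i)%VS = fullv.
Proof.
have [NA HA] := gcomp_full A; have [NB HB] := gcomp_full B.
exists (NA + NB)%N => N leN; apply/vspaceP => M; rewrite memvf [M]tens_span.
apply: memv_suml => i _; apply: memv_suml => j _; rewrite memvZ //.
move: (vbasis {:A})`_i (vbasis {:B})`_j => a b.
have := memvf a; rewrite -HA => /memv_sumP[u uA ->].
have := memvf b; rewrite -HB => /memv_sumP[v vB ->].
under eq_bigr do rewrite -[u _]scale1r.
under [X in tens _ X]eq_bigr do rewrite -[v _]scale1r.
rewrite bilin_sum; last exact: tens_bilin.
apply: memv_suml => p _; apply: memv_suml => q _; rewrite memvZ //.
have lt : (p + q < N)%N.
  by apply: leq_trans leN; rewrite -addSn leq_add // ltnW.
by rewrite memvE (sumv_sup (Ordinal lt)) //= -memvE mem_tensor_comp ?uA ?vB.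
Qed.

Fact sum_dim_gcomp (C : gradedAlg k) N :
  (\sum_(i < N) \dim (gcomp C i) <= \dim {:C})%N.
Proof.
have := gcomp_direct C N; rewrite directvE /= => /eqP <-.
exact: dimvS (subvf _).
Qed.

Fact sum_dim_tensor_comp N :
  (\sum_(i < N) \dim (tensor_comp i) <= \dim {: tensor_type A B})%N.
Proof.
have -> : \dim {: tensor_type A B} = (\dim {:A} * \dim {:B})%N.
  by rewrite dimvf /tensor_type dim_matrix.
apply: leq_trans (leq_mul (sum_dim_gcomp A N) (sum_dim_gcomp B N)).
rewrite big_distrl /=.
have le1 (i : 'I_N) : (\dim (tensor_comp i) <=
    \sum_(a < N | a <= i) \dim (gcomp A a) * \dim (gcomp B (i - a)))%N.
  apply: leq_trans (dimv_leq_sum _ _ _) _.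
  pose F a := (\dim (gcomp A a) * \dim (gcomp B (i - a)))%N.
  apply: (@leq_trans (\sum_(a < i.+1) F a)%N).
    by apply: leq_sum => a _; apply: dim_tensorv.
  by rewrite (big_ord_widen _ F (ltn_ord i)).
have /leq_trans : (\sum_(i < N) \dim (tensor_comp i) <=
    \sum_(i < N) \sum_(a < N | a <= i) \dim (gcomp A a) * \dim (gcomp B (i - a)))%N.
  by apply: leq_sum => i _; apply: le1.
apply.
rewrite (exchange_big_dep predT) //=; apply: leq_sum => a _.
rewrite -big_distrr /= leq_mul2l; apply/orP; right.
rewrite -(big_mkord (fun i => a <= i)%N (fun i => \dim (gcomp B (i - a)))).
rewrite -(big_mkord predT (fun i => \dim (gcomp B i))).
rewrite (big_cat_nat (n := a)) //=; last exact: ltnW.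
rewrite big_nat_cond big1 ?add0n; last first.
  by move=> i /andP[/andP[_ ia] ai]; rewrite leqNgt ia in ai.
rewrite -{1}[a : nat]add0n big_addn.
rewrite [X in (_ <= X)%N](big_cat_nat (n := N - a)) ?leq_subr //=.
apply: leq_trans (leq_addr _ _).
rewrite big_mkcond /=; apply: leq_sum => i _.
by rewrite addnK leq_addl.
Qed.

(* Stated for an abstract G, as directv looks inside the body of tensor_comp. *)
Fact tensor_comp_direct_subdef (G : nat -> {vspace tensor_type A B}) N :
  G =1 tensor_comp -> directv (\sum_(i < N) G i).
Proof.
move=> GE; have [N0 full] := tensor_comp_full.
pose M := maxn N N0.
have dM : directv (\sum_(i < M) G i).
  have GMfull : (\sum_(i < M) G i)%VS = fullv.
    by rewrite -(full M (leq_maxr _ _)); apply: eq_bigr => i _; rewrite GE.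
  rewrite directvEgeq /= GMfull.
  by under eq_bigr do rewrite GE; apply: sum_dim_tensor_comp.
have leNM : (N <= M)%N by rewrite leq_maxl.
apply/(@directv_sum_independent _ _ _ _ (fun i : 'I_N => G i)) => u uG u0 i _.
pose w n := if insub n is Some j then u j else 0.
have wE (j : 'I_N) : w j = u j by rewrite /w valK.
move/(@directv_sum_independent _ _ _ _ (fun i : 'I_M => G i)): dM => dM.
rewrite -wE; apply: (dM (fun j => w j) _ _ (widen_ord leNM i)) => // [j _|].
  by rewrite /w; case: insubP => [j' _ <-|_]; [apply: uG | apply: mem0v].
rewrite -[RHS]u0 -(eq_bigr _ (fun j _ => wE j)) (big_ord_widen _ w leNM).
rewrite [RHS]big_mkcond; apply: eq_bigr => j _.
by case: ifP => // /negbT jN; rewrite /w insubN.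
Qed.

Definition tensor : gradedAlg k :=
  GradedAlg tensor_comp1 tensor_compM
    (fun N => tensor_comp_direct_subdef N (frefl tensor_comp))
    (let: ex_intro N H := tensor_comp_full in ex_intro _ N (H N (leqnn N))).

End TensorGraded.

(* k[x_1, ..., x_n] / (x_1^(d 1), ..., x_n^(d n)), a class being represented  *)
(* by its coefficients on the monomials with all exponents m i < d i. The     *)
(* argument d_gt0 makes the quotient a nonzero ring.                          *)
Definition monomial_ci_type (k : fieldType) n (d : 'I_n -> nat)
    (d_gt0 : forall i, (0 < d i)%N) : Type :=
  {ffun {dffun forall i, 'I_(d i)} -> k^o}.

Section MonomialCI.

Variables (k : fieldType) (n : nat) (d : 'I_n -> nat).
Hypothesis d_gt0 : forall i, (0 < d i)%N.

Local Notation box := {dffun forall i, 'I_(d i)}.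
Local Notation Q := (monomial_ci_type k d_gt0).

HB.instance Definition _ := Vector.on Q.

Definition box_mnm (b : box) : 'X_{1..n} := [multinom (b i : nat) | i < n].

Definition mci_proj (p : {mpoly k[n]}) : Q := [ffun b => p@_(box_mnm b)].

Definition mci_lift (u : Q) : {mpoly k[n]} := \sum_b u b *: 'X_[box_mnm b].

Definition mci_one : Q := mci_proj 1.
Definition mci_mul (u v : Q) : Q := mci_proj (mci_lift u * mci_lift v).

Lemma box_mnm_inj : injective box_mnm.
Proof.
move=> b b' eqb; apply/ffunP => i; apply: val_inj.
by move/mnmP: eqb => /(_ i); rewrite !mnmE.
Qed.

Lemma box_mnm_ex (m : 'X_{1..n}) :
  (forall i, (m i < d i)%N) -> exists b, m = box_mnm b.
Proof.
move=> md; exists [ffun i => Ordinal (md i)].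
by apply/mnmP => i; rewrite mnmE ffunE.
Qed.

Lemma mci_liftK : cancel mci_lift mci_proj.
Proof.
move=> u; apply/ffunP => b; rewrite ffunE /mci_lift linear_sum (bigD1 b) //=.
rewrite mcoeffZ mcoeffX eqxx mulr1 big1 ?addr0 // => b' nb.
by rewrite mcoeffZ mcoeffX (inj_eq box_mnm_inj) (negPf nb) mulr0.
Qed.

Fact mci_proj_linear : linear mci_proj.
Proof. by move=> c p q; apply/ffunP => b; rewrite !ffunE mcoeffD mcoeffZ. Qed.

HB.instance Definition _ :=
  GRing.isLinear.Build k {mpoly k[n]} Q _ mci_proj mci_proj_linear.

Lemma mci_proj_mul0 p q : mci_proj p = 0 -> mci_proj (p * q) = 0.
Proof.
move=> p0; apply/ffunP => b; rewrite !ffunE mcoeffM big1 // => -[m1 m2] /= /eqP bE.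
have [b1 ->] : exists b1, (m1 : 'X_{1..n}) = box_mnm b1.
  apply: box_mnm_ex => i; move/mnmP: bE => /(_ i); rewrite mnmDE mnmE => bE.
  by apply: leq_ltn_trans (ltn_ord (b i)); rewrite bE leq_addr.
by move/ffunP: p0 => /(_ b1); rewrite !ffunE => ->; rewrite mul0r.
Qed.

Lemma mci_proj_mull p q : mci_proj (mci_lift (mci_proj p) * q) = mci_proj (p * q).
Proof.
apply/eqP; rewrite -subr_eq0 -linearB /= -mulrBl mci_proj_mul0 //.
by rewrite linearB /= mci_liftK subrr.
Qed.

Lemma mci_proj_mulr p q : mci_proj (p * mci_lift (mci_proj q)) = mci_proj (p * q).
Proof. by rewrite mulrC mci_proj_mull mulrC. Qed.

Fact mci_mulA : associative mci_mul.
Proof. by move=> u v w; rewrite /mci_mul mci_proj_mull mci_proj_mulr mulrA. Qed.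

Fact mci_mul1 : left_id mci_one mci_mul.
Proof. by move=> u; rewrite /mci_mul mci_proj_mull mul1r mci_liftK. Qed.

Fact mci_mulr1 : right_id mci_one mci_mul.
Proof. by move=> u; rewrite /mci_mul mci_proj_mulr mulr1 mci_liftK. Qed.

Fact mci_projM p q : mci_proj (p * q) = mci_mul (mci_proj p) (mci_proj q).
Proof. by rewrite /mci_mul mci_proj_mull mci_proj_mulr. Qed.

Fact mci_mul_addl : left_distributive mci_mul +%R.
Proof.
move=> u v w; rewrite -[u]mci_liftK -[v]mci_liftK -[w]mci_liftK.
by rewrite -linearD -!mci_projM mulrDl linearD.
Qed.

Fact mci_mul_addr : right_distributive mci_mul +%R.
Proof.
move=> u v w; rewrite -[u]mci_liftK -[v]mci_liftK -[w]mci_liftK.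
by rewrite -linearD -!mci_projM mulrDr linearD.
Qed.

Fact mci_one_neq0 : mci_one != 0.
Proof.
have [b b0] : exists b, 0%MM = box_mnm b.
  by apply: box_mnm_ex => i; rewrite mnm0E.
apply/eqP => /ffunP/(_ b)/eqP; rewrite !ffunE -b0 mcoeff1 eqxx.
exact/negP/oner_neq0.
Qed.

HB.instance Definition _ := GRing.Zmodule_isNzRing.Build Q
  mci_mulA mci_mul1 mci_mulr1 mci_mul_addl mci_mul_addr mci_one_neq0.

Fact mci_scaleAl c (u v : Q) : c *: (u * v) = (c *: u) * v.
Proof.
have -> : c *: u = mci_proj (c *: mci_lift u) by rewrite linearZ /= mci_liftK.
rewrite -[RHS]/(mci_mul _ _) /mci_mul mci_proj_mull -scalerAl linearZ /=.
by [].
Qed.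

HB.instance Definition _ := GRing.Lmodule_isLalgebra.Build k Q mci_scaleAl.

Fact mci_scaleAr c (u v : Q) : c *: (u * v) = u * (c *: v).
Proof.
have -> : c *: v = mci_proj (c *: mci_lift v) by rewrite linearZ /= mci_liftK.
rewrite -[RHS]/(mci_mul _ _) /mci_mul mci_proj_mulr -scalerAr linearZ /=.
by [].
Qed.

HB.instance Definition _ := GRing.Lalgebra_isAlgebra.Build k Q mci_scaleAr.
HB.instance Definition _ := Algebra_isFalgebra.Build k Q.

Fact mci_proj_monoid : monoid_morphism mci_proj.
Proof. by split=> // p q; apply: mci_projM. Qed.

HB.instance Definition _ :=
  GRing.isMonoidMorphism.Build {mpoly k[n]} Q mci_proj mci_proj_monoid.

Lemma mci_proj_surj u : exists p, mci_proj p = u.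
Proof. by exists (mci_lift u); apply: mci_liftK. Qed.

Lemma mci_proj_ker p :
  mci_proj p = 0 <-> exists q : 'I_n -> {mpoly k[n]}, p = \sum_i q i * 'X_i ^+ d i.
Proof.
split=> [p0|[q ->]]; last first.
  rewrite linear_sum big1 // => i _ /=; rewrite mulrC mci_proj_mul0 //.
  apply/ffunP => b; rewrite !ffunE mpolyXn mcoeffX; case: eqP => // /mnmP/(_ i).
  rewrite mulmnE mnm1E eqxx mul1n mnmE => bE.
  by have := ltn_ord (b i); rewrite -bE ltnn.
rewrite [p]mpolyE big_seq.
elim/big_ind: _ => [|_ _ [q ->] [r ->]|m mp].
- by exists (fun=> 0); rewrite big1 // => i _; rewrite mul0r.
- exists (fun i => q i + r i); rewrite -big_split.
  by apply: eq_bigr => i _; rewrite mulrDl.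
have [i dm] : exists i, (d i <= m i)%N.
  apply/existsP; rewrite -[[exists _, _]]negbK negb_exists; apply/forallP => md.
  have [b mb] : exists b, m = box_mnm b.
    by apply: box_mnm_ex => i; rewrite ltnNge md.
  move: mp; rewrite mcoeff_msupp mb; case/eqP.
  by move/ffunP: p0 => /(_ b); rewrite !ffunE.
exists (fun j => if j == i then p@_m *: 'X_[m - U_(i) *+ d i] else 0).
rewrite (bigD1 i) //= eqxx big1 ?addr0 => [|j /negPf->]; last by rewrite mul0r.
rewrite -scalerAl mpolyXn -mpolyXD submK //.
apply/mnm_lepP => j; rewrite mulmnE mnm1E; case: eqP => [<-|_]; last by [].
by rewrite mul1n.
Qed.

Fact mci_proj_homog : homogeneous_kernel mci_proj.
Proof.
move=> p p0 i; apply/ffunP => b; rewrite !ffunE.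
rewrite pihomogE linear_sum /= big1 // => m _.
rewrite mcoeffZ mcoeffX; case: eqP => [->|_]; last by rewrite mulr0.
by move/ffunP: p0 => /(_ b); rewrite !ffunE => ->; rewrite mul0r.
Qed.

Definition monomial_ci : gradedAlg k :=
  presented_alg mci_proj_surj mci_proj_homog.

Lemma monomial_ci_standard : standard_graded monomial_ci.
Proof.
by exists n, mci_proj; split; [exact: mci_proj_surj | exact: mci_proj_homog | ].
Qed.

End MonomialCI.

Arguments monomial_ci k {n d} d_gt0.

(* k[x] / (x^d), as the one-variable case. *)
Definition truncated_poly (k : fieldType) (d : nat) (d_gt0 : (0 < d)%N) :
    gradedAlg k :=
  monomial_ci k (d := fun _ : 'I_1 => d) (fun=> d_gt0).

(* k[x_1, ..., x_n] / (x_1^2, ..., x_n^2) *)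
Definition squarefree_alg (k : fieldType) (n : nat) : gradedAlg k :=
  monomial_ci k (d := fun _ : 'I_n => 2%N) (fun=> isT).

Section Lefschetz.

Variables (k : fieldType) (A : gradedAlg k).

Definition mul_full_rank (l : A) (i t : nat) : Prop :=
  {in gcomp A i &, injective ( *%R (l ^+ t))} \/
  (amull (l ^+ t) @: gcomp A i)%VS = gcomp A (i + t).

Definition WLP : Prop :=
  exists2 l, l \in gcomp A 1 & forall i, mul_full_rank l i 1.

Definition SLP : Prop :=
  exists2 l, l \in gcomp A 1 & forall i t, (1 <= t)%N -> mul_full_rank l i t.

Definition socle_degree (D : nat) : Prop :=
  gcomp A D != 0%VS /\ forall i, (D < i)%N -> gcomp A i = 0%VS.

(* Indexed by int, to encode the convention h_i = 0 for i < 0. *)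
Definition hilb (i : int) : nat :=
  if i is Posz j then \dim (gcomp A j) else 0%N.

Definition almost_centered : Prop :=
  (forall i j : int, i < j -> (hilb i < hilb j)%N ->
     forall s : nat, (hilb (i - s%:Z) <= hilb (j + s%:Z))%N) /\
  (forall i j : int, i < j -> (hilb j < hilb i)%N ->
     forall s : nat, (hilb (j + s%:Z) <= hilb (i - s%:Z))%N).

End Lefschetz.

(* Main.v *)
(* For l in A_1 and an integer e call e good when the maps                    *)
(* l^(j-i) : A_i -> A_j with i < j and i + j = e are all injective or all     *)
(* surjective (rank_centered l says that every e is good). Both (a) and (b)   *)
(* hold iff A has some l for which every e is good.                           *)
(* If every e is good for l and B is a monomial complete intersection of      *)
(* socle degree N with sum of variables E, then sl2-theory makes              *)
(* E^m : B_r -> B_(r+m) injective for 2r+m <= N and surjective for            *)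
(* 2r+m >= N. A descending induction on the degree in B then turns goodness   *)
(* of 2i+1-N into full rank of l+E on (A (x) B)_i. Full rank of (l+E)^t on    *)
(* A (x) B is full rank of l+E+y on A (x) B (x) k[y]/(y^t).                   *)
(* Conversely, let l^mu v = 0 with mu minimal. The span of the l^p v (x) B is *)
(* stable under any linear form l+u, and counting its dimension in two        *)
(* degrees gives a kernel element of (l+u)^t; dually for cokernels. For       *)
(* B = k[x]/(x^d), d large, this shows that (c) makes every e good. For       *)
(* B = k[x_1..x_n]/(x_i^2) only the e of the parity of n+1 are obtained, so   *)
(* two consecutive n and a general member of the pencil spanned by the two    *)
(* linear forms are used.                                                     *)

Require Import Defs.
From mathcomp Require Import all_boot all_order all_algebra all_field.
From HB Require Import structures.
From mathcomp Require Import mpoly zify ring.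
Import Order.TTheory GRing.Theory Num.Theory.
Local Open Scope ring_scope.

Set Implicit Arguments.
Unset Strict Implicit.
Unset Printing Implicit Defensive.

(** Each of the five conditions amounts to the existence of a form l in A_1 that is [rank_centered]:
    on every antidiagonal i + j = e the maps l^(j-i) from A_i to A_j are all injective or all
    surjective. Taking dimensions, the Hilbert function is then monotone along every antidiagonal
    ([sum_centered]), which is the same as almost centered ([sum_almost_centered]) and the same as
    the inequalities of (b) ([sum_centered_interlaced], [interlaced_or_sum_centered]). Under SLP the
    comparison of dimensions in turn decides between injective and surjective ([SLP_rank_centered]).

    A monomial complete intersection B of socle degree N is an sl2-module whose raising operator E
    is multiplication by the sum of the variables ([sl2_mci]). Put L = l + E on A (x) B. Since l and
    E commute and are opposite on the kernel of L and modulo its image, powers of one can be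
    exchanged for powers of the other. Where E alone does not decide, what remains is a power l^m,
    always on the antidiagonal 2i + 1 - N when L starts in degree i ([tot_inj1], [tot_surj1]).
    Adjoining y with y^t = 0 reduces L^t to a first power ([lefschetz_power]), whence
    [rank_centered_tensor_SLP].

    Conversely, a nonzero v with l^mu v = 0, mu minimal, generates in A (x) B a shifted copy of
    k[z]/(z^mu) (x) B. If that copy loses dimension between two degrees, L is not injective between
    them; the dual argument handles surjectivity ([count_inj], [count_surj]).
    [SLP_truncated_rank_centered] and [WLP_squarefree_rank_centered] choose B and the degrees so
    that the loss occurs; the latter obtains two forms, one for each parity of e, and takes a
    general member of their pencil ([generic_WLP]). *)

Section IterLinear.

Variables (k : fieldType) (W : lmodType k) (f : {linear W -> W}).

Lemma iter_linear0 m : iter m f 0 = 0.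
Proof. by elim: m => //= m ->; rewrite linear0. Qed.

Lemma iter_linearN m x : iter m f (- x) = - iter m f x.
Proof. by elim: m => //= m ->; rewrite linearN. Qed.

Lemma iter_linearZ m c x : iter m f (c *: x) = c *: iter m f x.
Proof. by elim: m => //= m ->; rewrite linearZ. Qed.

Lemma iter_linearD m x y : iter m f (x + y) = iter m f x + iter m f y.
Proof. by elim: m => //= m ->; rewrite linearD. Qed.

Fact iter_is_linear m : linear (iter m f).
Proof. by move=> c u v; rewrite iter_linearD iter_linearZ. Qed.

HB.instance Definition _ m :=
  GRing.isLinear.Build k W W _ (iter m f) (iter_is_linear m).

End IterLinear.

(** * sl2-representations *)

Lemma pchar0_intr_eq0 (k : fieldType) : [pchar k] =i pred0 ->
  forall z : int, (z%:~R == 0 :> k) = (z == 0).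
Proof.
move=> k0; have nat0 n : (n%:R == 0 :> k) = (n == 0%N) by apply: (pcharf0P k).1.
case=> n; first by rewrite -pmulrn nat0.
by rewrite NegzE mulrNz oppr_eq0 -pmulrn nat0.
Qed.

Section Sl2.

Variables (k : fieldType) (k0 : [pchar k] =i pred0) (V : lmodType k).
Variables (E F : {linear V -> V}) (P : int -> V -> Prop) (N : int).
Hypothesis P0 : forall r, P r 0.
Hypothesis P_lin : forall r c u v, P r u -> P r v -> P r (c *: u + v).
Hypothesis PE : forall r v, P r v -> P (r + 1) (E v).
Hypothesis PF : forall r v, P r v -> P (r - 1) (F v).
Hypothesis P_neg : forall (r : int) v, r < 0 -> P r v -> v = 0.
Hypothesis P_big : forall (r : int) v, N < r -> P r v -> v = 0.
Hypothesis EF : forall r v, P r v -> E (F v) - F (E v) = (2 * r - N)%:~R *: v.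

Lemma sl2_iter_in (r : int) (m : nat) v : P r v -> P (r + m%:Z) (iter m E v).
Proof.
move=> Prv; elim: m => [|m IH] /=; first by rewrite addr0.
by (have -> : r + m.+1%:Z = r + m%:Z + 1 by lia); exact: PE.
Qed.

(** The weights 2r - N, 2r + 2 - N, ..., 2r + 2m - N met along the string of v add up to (m+1)(2r +
    m - N). *)
Lemma sl2_comm (r : int) (m : nat) v : P r v ->
  iter m.+1 E (F v) - F (iter m.+1 E v)
    = (m.+1%:Z * (2 * r + m%:Z - N))%:~R *: iter m E v.
Proof.
move=> Prv; elim: m => [|m IH].
  by rewrite /= (EF Prv); congr (_%:~R *: _); lia.
have H := EF (sl2_iter_in m.+1 Prv).
have -> : iter m.+2 E (F v) = E (iter m.+1 E (F v)) by [].
have -> : iter m.+2 E v = E (iter m.+1 E v) by [].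
rewrite -[iter m.+1 E (F v)](subrK (F (iter m.+1 E v))) IH linearD linearZ /=.
rewrite -addrA -[E (iter m E v)]/(iter m.+1 E v) H -scalerDl -intrD.
by congr (_%:~R *: _); lia.
Qed.

(** Induction on the degree, then on m, in place of a decomposition into strings. If E^(m+1) v = 0,
    then [sl2_comm] gives E^(m+2) (F v) = 0 one degree lower, so F v = 0. The same formula for
    E^(m+1) then kills a multiple of E^m v by a negative integer. *)
Lemma sl2_inj (r : int) (m : nat) v : 2 * r + m%:Z <= N -> P r v -> iter m E v = 0 -> v = 0.
Proof.
have [n] : exists n : nat, r < n%:Z by exists (absz (r + 1)); lia.
elim: n r m v => [|n IHn] r m v rn; first by move=> _ Prv _; apply: P_neg Prv.
elim: m => [|m IHm] // le Prv Em0.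
have Em20 : iter m.+2 E v = 0 by rewrite iterS Em0 linear0.
have F0 : F v = 0.
  apply: (IHn (r - 1) m.+2) => //; [lia|lia|exact: PF|].
  by have := sl2_comm m.+1 Prv; rewrite Em20 Em0 linear0 subr0 scaler0.
apply: IHm => //; first by lia.
have := sl2_comm m Prv; rewrite Em0 F0 linear0 iter_linear0 subr0 => /esym/eqP.
rewrite scaler_eq0 pchar0_intr_eq0 // => /orP[|/eqP//].
by rewrite mulf_eq0 => /orP[]/eqP; lia.
Qed.

(** Descending induction on the target degree, then induction on m. Write v = E^m w and E v =
    E^(m+3) u; moving F across both powers expresses a positive multiple of v as E^(m+1) applied to
    F w - E^2 F u + c1 E u. *)
Lemma sl2_surj (r : int) (m : nat) v : N <= 2 * r + m%:Z -> P (r + m%:Z) v ->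
  exists2 u, P r u & v = iter m E u.
Proof.
have [n] : exists n : nat, N < r + m%:Z + n%:Z by exists (absz (N - r - m%:Z + 1)); lia.
elim: n r m v => [|n IHn] r m v Nn.
  move=> _ Pv; exists 0; first exact: P0.
  by rewrite iter_linear0; apply: P_big Pv; lia.
elim: m r Nn => [|m IHm] r Nn le Pv; first by exists v => //; rewrite -[r]addr0.
have [w Pw vw] : exists2 w, P (r + 1) w & v = iter m E w.
  by apply: IHm; [lia|lia|rewrite (_ : r + 1 + m%:Z = r + m.+1%:Z) //; lia].
have [u Pu Evu] : exists2 u, P (r - 1) u & E v = iter m.+3 E u.
  apply: IHn; [lia|lia|].
  by rewrite (_ : r - 1 + m.+3%:Z = r + m.+1%:Z + 1); [apply: PE | lia].
have := sl2_comm m Pw; rewrite -vw -[iter m.+1 E w]/(E (iter m E w)) -vw Evu.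
have /(canRL (subKr _)) -> := sl2_comm m.+2 Pu.
set c1 := (X in X%:~R *: iter m.+2 E u); set c2 := (X in X%:~R *: v).
have c20 : (c2%:~R : k) != 0 by rewrite pchar0_intr_eq0 // mulf_neq0 //; lia.
move=> /(congr1 (fun x => c2%:~R^-1 *: x)); rewrite scalerA mulVf // scale1r => <-.
have PEr x : P (r - 1) x -> P r (E x) by move/PE; rewrite subrK.
have PEr' x : P (r - 1 - 1) x -> P (r - 1) (E x) by move/PE; rewrite subrK.
have PFr x : P (r + 1) x -> P r (F x) by move/PF; rewrite addrK.
exists (c2%:~R^-1 *: (F w - iter 2 E (F u) + c1%:~R *: E u)).
  rewrite -[_ *: _]addr0; apply: P_lin; last exact: P0.
  rewrite addrC; apply: P_lin; first exact: PEr.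
  rewrite addrC -scaleN1r; apply: P_lin; last exact: PFr.
  exact/PEr/PEr'/PF.
rewrite iter_linearZ !iter_linearD iter_linearZ iter_linearN -iterD -iterSr addn2.
by congr (_ *: _); rewrite opprB addrA addrAC.
Qed.

End Sl2.

(** * Operators on U (x) B in coordinates *)

Section KernelAction.

Variables (k : fieldType) (U : vectType k) (J : finType).
Implicit Types (K : J -> J -> k) (l : {linear U -> U}) (w : {ffun J -> U}).

(** With J a basis of B, a function w stands for the sum of the w b (x) b in U (x) B. Then [kact K]
    is 1 (x) K, [pact l] is l (x) 1, and [lop l K] is their sum. *)
Definition kact K w : {ffun J -> U} := [ffun b => \sum_c K b c *: w c].

Definition pact l w : {ffun J -> U} := [ffun b => l (w b)].

Definition lop l K w : {ffun J -> U} := pact l w + kact K w.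

Fact kact_linear K : linear (kact K).
Proof.
move=> c u v; apply/ffunP => b; rewrite !ffunE scaler_sumr -big_split.
by apply: eq_bigr => b' _; rewrite !ffunE scalerDr !scalerA mulrC.
Qed.

HB.instance Definition _ K :=
  GRing.isLinear.Build k {ffun J -> U} {ffun J -> U} _ (kact K) (@kact_linear K).

Fact pact_linear l : linear (pact l).
Proof. by move=> c u v; apply/ffunP => b; rewrite !ffunE linearP. Qed.

HB.instance Definition _ l :=
  GRing.isLinear.Build k {ffun J -> U} {ffun J -> U} _ (pact l) (@pact_linear l).

Fact lop_linear l K : linear (lop l K).
Proof.
by move=> c u v; rewrite /lop !linearP scalerDr !addrA; congr (_ + _); rewrite addrAC.
Qed.

HB.instance Definition _ l K :=
  GRing.isLinear.Build k {ffun J -> U} {ffun J -> U} _ (lop l K) (@lop_linear l K).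

Lemma lopE l K w b : lop l K w b = l (w b) + \sum_c K b c *: w c.
Proof. by rewrite !ffunE. Qed.

Lemma pact_kact l K w : pact l (kact K w) = kact K (pact l w).
Proof.
apply/ffunP => b; rewrite !ffunE linear_sum; apply: eq_bigr => c _.
by rewrite ffunE linearZ.
Qed.

Lemma iter_pactE l m w b : iter m (pact l) w b = iter m l (w b).
Proof. by elim: m => //= m IH; rewrite ffunE IH. Qed.

End KernelAction.

(** An sl2-module given by matrices in a basis of weight vectors, a vector of degree r having weight
    2r - N. *)
Definition sl2_data (k : fieldType) (J : finType) (deg : J -> int) (N : int)
    (E F : J -> J -> k) : Prop :=
  [/\ forall b c, E b c != 0 -> deg b = deg c + 1,
      forall b c, F b c != 0 -> deg b = deg c - 1,
      forall b b', \sum_c (E b c * F c b' - F b c * E c b')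
                     = (2 * deg b - N)%:~R * (b == b')%:R
    & forall b, 0 <= deg b <= N].

(** * Multiplication by l + E on the tensor product with an sl2-module *)

Section GradedOperator.

Variables (k : fieldType) (U : vectType k) (Ug : int -> {vspace U}).
Variable (l : {linear U -> U}).

Definition inj_at (a : int) (m : nat) : Prop :=
  forall v, v \in Ug a -> iter m l v = 0 -> v = 0.

Definition surj_at (a : int) (m : nat) : Prop :=
  forall v, v \in Ug (a + m%:Z) -> exists2 u, u \in Ug a & v = iter m l u.

(** With j = a + m the equation reads a + j = e, so this concerns all powers of l between two
    degrees of the antidiagonal e. *)
Definition inj_sum (e : int) : Prop :=
  forall (a : int) (m : nat), 2 * a + m%:Z = e -> inj_at a m.

Definition surj_sum (e : int) : Prop :=
  forall (a : int) (m : nat), 2 * a + m%:Z = e -> surj_at a m.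

Section Total.

Variables (J : finType) (deg : J -> int) (K : J -> J -> k).
Hypothesis lU : forall a v, v \in Ug a -> l v \in Ug (a + 1).

Definition tot_deg (i : int) (w : {ffun J -> U}) : Prop :=
  forall b, w b \in Ug (i - deg b).

Definition tot_inj (i : int) (t : nat) : Prop :=
  forall w, tot_deg i w -> iter t (lop l K) w = 0 -> w = 0.

Definition tot_surj (i : int) (t : nat) : Prop :=
  forall w, tot_deg (i + t%:Z) w ->
    exists2 u, tot_deg i u & w = iter t (lop l K) u.

Lemma tot_degD i u w : tot_deg i u -> tot_deg i w -> tot_deg i (u + w).
Proof. by move=> ui wi b; rewrite ffunE rpredD. Qed.

Lemma tot_degN i u : tot_deg i u -> tot_deg i (- u).
Proof. by move=> ui b; rewrite ffunE rpredN. Qed.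

Lemma tot_degZ i c u : tot_deg i u -> tot_deg i (c *: u).
Proof. by move=> ui b; rewrite ffunE memvZ. Qed.

Lemma tot_deg0 i : tot_deg i 0.
Proof. by move=> b; rewrite ffunE mem0v. Qed.

Lemma tot_deg_pact i w : tot_deg i w -> tot_deg (i + 1) (pact l w).
Proof. by move=> wi b; rewrite ffunE addrAC lU. Qed.

Hypothesis Kdeg : forall b c, K b c != 0 -> deg b = deg c + 1.

Lemma tot_deg_kact i w : tot_deg i w -> tot_deg (i + 1) (kact K w).
Proof.
move=> wi b; rewrite ffunE; apply: memv_suml => c _.
have [->|/Kdeg ->] := eqVneq (K b c) 0; first by rewrite scale0r mem0v.
by rewrite opprD addrACA subrr addr0 memvZ.
Qed.

Lemma tot_deg_lop i w : tot_deg i w -> tot_deg (i + 1) (lop l K w).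
Proof. by move=> wi; apply: tot_degD; [apply: tot_deg_pact | apply: tot_deg_kact]. Qed.

Lemma tot_deg_iter_lop i t w : tot_deg i w -> tot_deg (i + t%:Z) (iter t (lop l K) w).
Proof.
move=> wi; elim: t => [|t IH]; first by rewrite addr0.
by rewrite (_ : i + t.+1%:Z = i + t%:Z + 1); [apply: tot_deg_lop | lia].
Qed.

End Total.

Section Lefschetz1.

Variables (k0 : [pchar k] =i pred0).
Variables (J : finType) (deg : J -> int) (N : int) (E F : J -> J -> k).
Hypothesis lU : forall a v, v \in Ug a -> l v \in Ug (a + 1).
Hypothesis sl2EF : sl2_data deg N E F.

Local Notation L := (lop l E).
Local Notation tdeg := (tot_deg deg).

(** This is S (x) B_r. For fixed S these spaces are stable under [kact E] and [kact F], which lets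
    [sl2_inj] and [sl2_surj] act with coefficients in S. *)
Definition in_deg (S : {vspace U}) (r : int) (w : {ffun J -> U}) : Prop :=
  forall b, w b \in S /\ (deg b != r -> w b = 0).

Definition comp_deg (r : int) (w : {ffun J -> U}) : {ffun J -> U} :=
  [ffun b => if deg b == r then w b else 0].

Lemma in_deg0 S r : in_deg S r 0.
Proof. by move=> b; rewrite ffunE mem0v. Qed.

Lemma in_deg_lin S r c u v : in_deg S r u -> in_deg S r v -> in_deg S r (c *: u + v).
Proof.
move=> Pu Pv b; rewrite !ffunE; case: (Pu b) (Pv b) => [ub u0] [vb v0].
by split=> [|br]; rewrite ?rpredD ?memvZ // u0 // v0 // scaler0 addr0.
Qed.

Lemma in_deg_kact S r d (K : J -> J -> k) v :
  (forall b c, K b c != 0 -> deg b = deg c + d) ->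
  in_deg S r v -> in_deg S (r + d) (kact K v).
Proof.
move=> Kd Pv b; rewrite ffunE; split=> [|br].
  by apply: memv_suml => c _; rewrite memvZ //; case: (Pv c).
apply: big1 => c _; have [->|/Kd db] := eqVneq (K b c) 0; first by rewrite scale0r.
by case: (Pv c) => _ ->; rewrite ?scaler0 //; lia.
Qed.

Lemma in_deg_comm S r v : in_deg S r v ->
  kact E (kact F v) - kact F (kact E v) = (2 * r - N)%:~R *: v.
Proof.
case: sl2EF => _ _ EF _ Pv; apply/ffunP => b; rewrite !ffunE.
under eq_bigr do rewrite ffunE scaler_sumr.
under [X in _ - X]eq_bigr do rewrite ffunE scaler_sumr.
rewrite exchange_big [X in _ - X]exchange_big -sumrB /=.
under eq_bigr => b' _.
  rewrite -sumrB; under eq_bigr do rewrite !scalerA -scalerBl.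
  rewrite -scaler_suml EF; over.
rewrite (bigD1 b) //= eqxx mulr1 big1 ?addr0 => [|b' /negPf].
  by have [->//|/(Pv b).2 ->] := eqVneq (deg b) r; rewrite !scaler0.
by rewrite eq_sym => ->; rewrite mulr0 scale0r.
Qed.

Lemma in_deg_out S r v : ~~ (0 <= r <= N) -> in_deg S r v -> v = 0.
Proof.
case: sl2EF => _ _ _ dN out Pv; apply/ffunP => b; rewrite ffunE.
by apply: (Pv b).2; apply: contraNneq out => <-.
Qed.

Lemma kact_inj S r m v : 2 * r + m%:Z <= N -> in_deg S r v ->
  iter m (kact E) v = 0 -> v = 0.
Proof.
case: (sl2EF) => dE dF _ _.
apply: (sl2_inj (F := kact F) (P := in_deg S) k0).
- by move=> r' v'; apply: in_deg_kact.
- by move=> r' v'; apply: in_deg_kact.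
- by move=> r' v' r'0; apply: in_deg_out; lia.
- exact: in_deg_comm.
Qed.

Lemma kact_surj S r m v : N <= 2 * r + m%:Z -> in_deg S (r + m%:Z) v ->
  exists2 u, in_deg S r u & v = iter m (kact E) u.
Proof.
case: (sl2EF) => dE dF _ _.
apply: (sl2_surj (F := kact F) (P := in_deg S) k0).
- exact: in_deg0.
- exact: in_deg_lin.
- by move=> r' v'; apply: in_deg_kact.
- by move=> r' v'; apply: in_deg_kact.
- by move=> r' v' r'0; apply: in_deg_out; lia.
- exact: in_deg_comm.
Qed.

Lemma in_deg_tdeg i r w : in_deg (Ug (i - r)) r w -> tdeg i w.
Proof.
move=> Pw b; case: (Pw b) => wb w0; have [->//|/w0 ->] := eqVneq (deg b) r.
by rewrite mem0v.
Qed.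

Lemma comp_deg_in i r w : tdeg i w -> in_deg (Ug (i - r)) r (comp_deg r w).
Proof.
move=> wi b; rewrite ffunE; have [<-|_] := eqVneq (deg b) r; first by split.
by rewrite mem0v.
Qed.

Lemma comp_deg_kact r w : comp_deg (r + 1) (kact E w) = kact E (comp_deg r w).
Proof.
case: sl2EF => dE _ _ _; apply/ffunP => b; rewrite !ffunE.
have [br|br] := eqVneq (deg b) (r + 1).
  apply: eq_bigr => c _; rewrite ffunE.
  have [->|/dE dbc] := eqVneq (E b c) 0; first by rewrite !scale0r.
  by have -> : deg c == r by lia.
rewrite big1 // => c _; rewrite ffunE.
have [->|/dE dbc] := eqVneq (E b c) 0; first by rewrite !scale0r.
by have /negPf-> : deg c != r; rewrite ?scaler0 //; lia.
Qed.

Lemma comp_deg_pact r w : comp_deg r (pact l w) = pact l (comp_deg r w).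
Proof.
by apply/ffunP => b; rewrite !ffunE; case: ifP => // _; rewrite linear0.
Qed.

Lemma pact_iter_kact m w :
  pact l (iter m (kact E) w) = iter m (kact E) (pact l w).
Proof. by elim: m => //= m <-; rewrite pact_kact. Qed.

Lemma iter_pact_kact m w :
  iter m (pact l) (kact E w) = kact E (iter m (pact l) w).
Proof. by elim: m => //= m ->; rewrite pact_kact. Qed.

(** Let w_r be the part of w of B-degree r. L w = 0 means l w_(r+1) = - E w_r, and w_r = 0 is shown
    by descending induction on r. Once w_(r+1) = 0, also E w_r = 0, which suffices in the lower half
    of B. In the upper half E^m w_(r-m) = (-1)^m l^m w_r is killed by E, so w_(r-m) = 0 and the
    hypothesis on l^m applies. *)
Lemma tot_inj1 i : inj_sum (2 * i + 1 - N) -> tot_inj deg E i 1.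
Proof.
move=> injl w wi /= Lw0.
have LwE r : pact l (comp_deg (r + 1) w) = - kact E (comp_deg r w).
  apply/eqP; rewrite -addr_eq0 -comp_deg_pact -comp_deg_kact.
  apply/eqP/ffunP => b; move/ffunP: Lw0 => /(_ b); rewrite /lop !ffunE.
  by case: eqP; rewrite ?addr0.
have LwE' r : pact l (comp_deg r w) = - kact E (comp_deg (r - 1) w).
  by rewrite -LwE subrK.
suff w0 (n : nat) (r : int) : N - r < n%:Z -> comp_deg r w = 0.
  apply/ffunP => b; have /ffunP/(_ b) : comp_deg (deg b) w = 0.
    by apply: (w0 (absz (N - deg b + 1)%R)); case: sl2EF => _ _ _ /(_ b); lia.
  by rewrite !ffunE eqxx.
elim: n r => [|n IHn] r rn.
  by apply: (@in_deg_out (Ug (i - r)) r); [lia | apply: comp_deg_in].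
have Er0 : kact E (comp_deg r w) = 0.
  by apply/eqP; rewrite -oppr_eq0 -LwE IHn ?linear0 //; lia.
have [le|lt] := leP (2 * r + 1) N; first exact: (@kact_inj _ r 1 _ le (comp_deg_in r wi) Er0).
(* With this m, 2(r - m) + (m + 1) = N makes E^(m+1) injective on B_(r-m), and 2(i - r) + m = 2i + 1
   - N is the antidiagonal of [injl]. *)
pose m := absz (2 * r + 1 - N)%R.
have itE (s : nat) : iter s (kact E) (comp_deg (r - s%:Z) w)
    = (-1) ^+ s *: iter s (pact l) (comp_deg r w).
  elim: s => [|s IHs]; first by rewrite subr0 expr0 scale1r.
  have -> : r - s.+1%:Z = r - s%:Z - 1 by lia.
  rewrite iterSr -[kact E _]opprK -LwE' iter_linearN.
  rewrite -pact_iter_kact IHs linearZ /= exprS -scalerA.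
  by rewrite scaleN1r.
have wm0 : comp_deg (r - m%:Z) w = 0.
  apply: (@kact_inj _ (r - m%:Z) m.+1 _ _ (comp_deg_in _ wi)); first by lia.
  rewrite iterS itE linearZ /= -iter_pact_kact Er0.
  by rewrite iter_linear0 scaler0.
move: (itE m); rewrite wm0 iter_linear0 => /esym/eqP.
rewrite scaler_eq0 signr_eq0 /= => /eqP lm0.
apply/ffunP => b; rewrite ffunE [RHS]ffunE; case: eqP => // br.
apply: (injl (i - r) m); first by lia.
  by rewrite -br.
by move/ffunP: lm0 => /(_ b); rewrite iter_pactE !ffunE br eqxx.
Qed.

Definition in_image i w := exists2 u, tdeg i u & w = L u.

Lemma in_imageD i u v : in_image i u -> in_image i v -> in_image i (u + v).
Proof.
move=> [u' u'i ->] [v' v'i ->]; exists (u' + v'); first exact: tot_degD.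
by rewrite linearD.
Qed.

Lemma in_imageN i u : in_image i u -> in_image i (- u).
Proof.
by move=> [u' u'i ->]; exists (- u'); [exact: tot_degN | rewrite linearN].
Qed.

(** As l and E commute, l^m - (-E)^m is a multiple of l + E: modulo the image of L, l acts as -E. *)
Lemma pact_kact_image i (m : nat) s : tdeg (i + 1 - m%:Z) s ->
  in_image i (iter m (pact l) s - (-1) ^+ m *: iter m (kact E) s).
Proof.
case: (sl2EF) => dE _ _ _.
elim: m s => [|m IHm] s si.
  by rewrite expr0 scale1r subrr; exists 0; [exact: tot_deg0 | rewrite linear0].
have -> : iter m.+1 (pact l) s - (-1) ^+ m.+1 *: iter m.+1 (kact E) s
  = L (iter m (pact l) s) -
    (iter m (pact l) (kact E s) - (-1) ^+ m *: iter m (kact E) (kact E s)).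
  rewrite /lop opprB addrA addrAC iter_pact_kact.
  by rewrite addrK -iterSr /= exprS mulN1r scaleNr opprK.
apply: in_imageD.
  exists (iter m (pact l) s) => //.
  have H (j : nat) : tdeg (i - m%:Z + j%:Z) (iter j (pact l) s).
    elim: j => [|j IHj] /=; first by move: si; congr tot_deg; lia.
    have -> : i - m%:Z + j.+1%:Z = i - m%:Z + j%:Z + 1 by lia.
    exact: tot_deg_pact.
  by have := H m; rewrite subrK.
apply: in_imageN; apply: IHm.
by have := tot_deg_kact dE si; congr tot_deg; lia.
Qed.

(** Modulo the image of L, an element of B-degree n is replaced by one of B-degree n - 1, until
    nothing is left. In the upper half of B it is some E u, congruent to - l u. In the lower half it
    is some l^m s, congruent up to sign to E^m s = E^(m+1) u, hence to a multiple of l^(m+1) u. *)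
Lemma tot_surj1 i : surj_sum (2 * i + 1 - N) -> tot_surj deg E i 1.
Proof.
case: (sl2EF) => dE _ _ dN surjl w wi.
suff H (n : nat) w' : tdeg (i + 1) w' -> (forall b, n%:Z <= deg b -> w' b = 0) ->
    in_image i w'.
  have [|u ui ->] := H (absz (N + 1)%R) w wi; last by exists u.
  by move=> b Nb; have := dN b; lia.
elim: n w' {w wi} => [|n IHn] w wi w0.
  exists 0; first exact: tot_deg0.
  by rewrite linear0; apply/ffunP => b; rewrite ffunE w0 //; have := dN b; lia.
have -> : w = (w - comp_deg n%:Z w) + comp_deg n%:Z w by rewrite subrK.
apply: in_imageD.
  apply: IHn => [|b nb].
    apply: tot_degD => //; apply: tot_degN.
    exact: in_deg_tdeg (comp_deg_in _ wi).
  rewrite !ffunE; have [_|nb'] := eqVneq (deg b) n%:Z; first by rewrite subrr.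
  by rewrite w0 ?subr0 //; lia.
have : in_deg (Ug (i + 1 - n%:Z)) n%:Z (comp_deg n%:Z w) by apply: comp_deg_in.
move: (comp_deg n%:Z w) => {w wi w0} w wi.
have IH' v : in_deg (Ug (i + 1 - (n%:Z - 1))) (n%:Z - 1) v -> in_image i v.
  move=> vi; apply: IHn => [|b nb]; first exact: in_deg_tdeg vi.
  by apply: (vi b).2; lia.
have pact_in (m : nat) (S S' : {vspace U}) r v : (forall x, x \in S -> iter m l x \in S') ->
    in_deg S r v -> in_deg S' r (iter m (pact l) v).
  move=> SS' vr b; rewrite iter_pactE; case: (vr b) => vb v0.
  by split=> [|br]; [exact: SS' | rewrite v0 ?iter_linear0].
have lUm (m : nat) a (x : U) : x \in Ug a -> iter m l x \in Ug (a + m%:Z).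
  move=> xa; elim: m => [|m IH] /=; first by rewrite addr0.
  by rewrite (_ : a + m.+1%:Z = a + m%:Z + 1); [apply: lU | lia].
have [le|lt] := leP (N + 1) (2 * n%:Z).
  have [u Pu wu] : exists2 u, in_deg (Ug (i + 1 - n%:Z)) (n%:Z - 1) u & w = iter 1 (kact E) u.
    by apply: kact_surj; [lia | rewrite subrK].
  have -> : w = L u - pact l u by rewrite wu /lop addrAC subrr add0r.
  apply: in_imageD.
    by exists u => //; apply: (@in_deg_tdeg _ (n%:Z - 1)); move: Pu; congr in_deg; congr Ug; lia.
  apply/in_imageN/IH'; apply: (pact_in 1%N) Pu => x /lU /=.
  by rewrite (_ : i + 1 - n%:Z + 1 = i + 1 - (n%:Z - 1)) //; lia.
(* With this m, 2(i + 1 - n - m) + m = 2i + 1 - N is the antidiagonal of [surjl], and 2(n - 1) + (m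
   + 1) = N makes E^(m+1) map B_(n-1) onto B_(n+m). *)
pose m := absz (N + 1 - 2 * n%:Z)%R.
have [s Ps ws] : exists2 s, in_deg (Ug (i + 1 - n%:Z - m%:Z)) n%:Z s & w = iter m (pact l) s.
  have /fin_all_exists [f Pf] (b : J) : exists x,
     [/\ x \in Ug (i + 1 - n%:Z - m%:Z), w b = iter m l x & deg b != n%:Z -> x = 0].
    have [bn|bn] := eqVneq (deg b) n%:Z.
      have [||x xU wx] := surjl (i + 1 - n%:Z - m%:Z) m _ (w b).
      - by lia.
      - by rewrite subrK; case: (wi b).
      by exists x.
    by exists 0; rewrite mem0v iter_linear0; split=> //; apply: (wi b).2.
  exists [ffun b => f b]; first by move=> b; rewrite ffunE; case: (Pf b).
  by apply/ffunP => b; rewrite iter_pactE ffunE; case: (Pf b).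
have [u Pu su] : exists2 u, in_deg (Ug (i + 1 - n%:Z - m%:Z)) (n%:Z - 1) u &
    iter m (kact E) s = iter m.+1 (kact E) u.
  apply: kact_surj; first by lia.
  have itE (j : nat) : in_deg (Ug (i + 1 - n%:Z - m%:Z)) (n%:Z + j%:Z) (iter j (kact E) s).
    elim: j => [|j IH] /=; first by rewrite addr0.
    by rewrite (_ : n%:Z + j.+1%:Z = n%:Z + j%:Z + 1); [apply: in_deg_kact | lia].
  by rewrite (_ : n%:Z - 1 + m.+1%:Z = n%:Z + m%:Z); [exact: itE | lia].
rewrite ws -[iter m (pact l) s](subrK ((-1) ^+ m *: iter m (kact E) s)).
apply: in_imageD.
  apply: pact_kact_image; apply: (@in_deg_tdeg _ n%:Z).
  by move: Ps; congr in_deg; congr Ug; lia.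
(* The remaining term (-1)^m E^(m+1) u is congruent to - l^(m+1) u, which has B-degree n - 1 and is
   covered by [IH']. *)
rewrite su.
rewrite -[_ *: _](addKr (iter m.+1 (pact l) u)) addrC.
apply: in_imageD; last first.
  apply/in_imageN/IH'; apply: (pact_in m.+1) Pu => x /(lUm m.+1).
  by congr (_ \in Ug _); lia.
have : in_image i (iter m.+1 (pact l) u - (-1) ^+ m.+1 *: iter m.+1 (kact E) u).
  apply: pact_kact_image; apply: (@in_deg_tdeg _ (n%:Z - 1)).
  by move: Pu; congr in_deg; congr Ug; lia.
by rewrite exprS mulN1r scaleNr opprK.
Qed.

End Lefschetz1.

End GradedOperator.

(** * Adjoining a truncated variable *)

Section KernelSum.

Variables (k : fieldType) (J1 J2 : finType).

(** The Kronecker sum K1 (x) 1 + 1 (x) K2 in the product basis. *)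
Definition ksum (K1 : J1 -> J1 -> k) (K2 : J2 -> J2 -> k) (x y : J1 * J2) : k :=
  K1 x.1 y.1 * (x.2 == y.2)%:R + (x.1 == y.1)%:R * K2 x.2 y.2.

Lemma sum_deltal (J : finType) (b : J) (f : J -> k) :
  \sum_c (b == c)%:R * f c = f b.
Proof.
rewrite (bigD1 b) //= eqxx mul1r big1 ?addr0 // => c /negPf.
by rewrite eq_sym => ->; rewrite mul0r.
Qed.

(** The two mixed terms are exchanged when the A's and B's are swapped, so they cancel in the
    commutator taken in [sl2_ksum]. *)
Lemma ksum_comp (A1 B1 : J1 -> J1 -> k) (A2 B2 : J2 -> J2 -> k) x y :
  \sum_z ksum A1 A2 x z * ksum B1 B2 z y
    = (\sum_c A1 x.1 c * B1 c y.1) * (x.2 == y.2)%:R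
      + A1 x.1 y.1 * B2 x.2 y.2 + B1 x.1 y.1 * A2 x.2 y.2
      + (x.1 == y.1)%:R * (\sum_c A2 x.2 c * B2 c y.2).
Proof.
rewrite -(pair_bigA _ (fun c1 c2 => ksum A1 A2 x (c1, c2) * ksum B1 B2 (c1, c2) y)).
have expand (c1 : J1) (c2 : J2) : ksum A1 A2 x (c1, c2) * ksum B1 B2 (c1, c2) y
   = (x.2 == c2)%:R * (A1 x.1 c1 * B1 c1 y.1 * (c2 == y.2)%:R)
     + (x.2 == c2)%:R * ((c1 == y.1)%:R * A1 x.1 c1 * B2 c2 y.2)
     + (x.1 == c1)%:R * (B1 c1 y.1 * A2 x.2 c2 * (c2 == y.2)%:R)
     + (x.1 == c1)%:R * ((c1 == y.1)%:R * (A2 x.2 c2 * B2 c2 y.2)).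
  by rewrite /ksum /=; ring.
under eq_bigr => c1 _.
  under eq_bigr do rewrite expand.
  rewrite !big_split /= !sum_deltal -!mulr_sumr.
  over.
rewrite !big_split /= !sum_deltal -mulr_suml -!addrA; congr (_ + (_ + (_ + _))).
- by under eq_bigr do rewrite -mulrA eq_sym; rewrite sum_deltal.
- by under eq_bigr do rewrite mulrC eq_sym; rewrite sum_deltal.
Qed.

Lemma sl2_ksum d1 N1 (E1 F1 : J1 -> J1 -> k) d2 N2 (E2 F2 : J2 -> J2 -> k) :
  sl2_data d1 N1 E1 F1 -> sl2_data d2 N2 E2 F2 ->
  sl2_data (fun x : J1 * J2 => d1 x.1 + d2 x.2) (N1 + N2) (ksum E1 E2) (ksum F1 F2).
Proof.
have kdeg d (K1 : J1 -> J1 -> k) (K2 : J2 -> J2 -> k) :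
    (forall b c, K1 b c != 0 -> d1 b = d1 c + d) ->
    (forall b c, K2 b c != 0 -> d2 b = d2 c + d) ->
  forall x y, ksum K1 K2 x y != 0 -> d1 x.1 + d2 x.2 = d1 y.1 + d2 y.2 + d.
  move=> K1d K2d x y; rewrite /ksum.
  have [->|ne1] := eqVneq x.1 y.1; have [->|ne2] := eqVneq x.2 y.2; rewrite ?mulr1n ?mulr0n.
  - rewrite mul1r mulr1; have [->|/K1d] := eqVneq (K1 y.1 y.1) 0; last by lia.
    by rewrite add0r => /K2d; lia.
  - by rewrite mulr0 add0r mul1r => /K2d ->; rewrite addrA.
  - by rewrite mul0r addr0 mulr1 => /K1d ->; rewrite addrAC.
  by rewrite mulr0 mul0r addr0 eqxx.
move=> [dE1 dF1 EF1 dN1] [dE2 dF2 EF2 dN2]; split.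
- exact: kdeg.
- exact: kdeg.
- move=> x y; rewrite sumrB !ksum_comp.
  move: (EF1 x.1 y.1) (EF2 x.2 y.2); rewrite !sumrB => /eqP + /eqP.
  rewrite !subr_eq => /eqP -> /eqP ->.
  rewrite [x == y]xpair_eqE.
  have -> : 2 * (d1 x.1 + d2 x.2) - (N1 + N2) = (2 * d1 x.1 - N1) + (2 * d2 x.2 - N2) by lia.
  rewrite intrD -mulnb natrM; ring.
- by move=> x; have := dN1 x.1; have := dN2 x.2; lia.
Qed.

End KernelSum.

Section String.

Variables (k : fieldType) (t : nat).

(** In the basis 1, y, ..., y^(t-1) of k[y]/(y^t), [strE] is multiplication by y and [strF] sends
    y^s to s (t - s) y^(s-1). *)
Definition strE (s s' : 'I_t) : k := ((s : nat) == s'.+1)%:R.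

Definition strF (s s' : 'I_t) : k := ((s' : nat) == s.+1)%:R * (s' * (t - s'))%:R.

(** The relation is b (t - b) - (b+1)(t - b - 1) = 2b - (t - 1). It survives at both ends of the
    string because s (t - s) vanishes at s = 0 and s = t. *)
Lemma sl2_string : sl2_data (fun s : 'I_t => s%:Z) (t%:Z - 1) strE strF.
Proof.
split=> [b c|b c|b b'|b].
- rewrite /strE; have [bc _|_] := eqVneq (b : nat) c.+1; [rewrite /=; lia | by rewrite eqxx].
- rewrite /strF; have [bc _|_] := eqVneq (c : nat) b.+1; [rewrite /=; lia | by rewrite mul0r eqxx].
- rewrite sumrB; have [<-|ne] := eqVneq b b'; last first.
    rewrite mulr0 !big1 ?subr0 // => c _; rewrite /strE /strF.
      have [bc|_] := eqVneq (c : nat) b.+1; last by rewrite !mul0r.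
      have [bc'|_] := eqVneq (c : nat) b'.+1; last by rewrite mulr0.
      by case/eqP: ne; apply: val_inj => /=; lia.
    have [bc|_] := eqVneq (b : nat) c.+1; last by rewrite mul0r.
    have [bc'|_] := eqVneq (b' : nat) c.+1; last by rewrite mul0r mulr0.
    by case/eqP: ne; apply: val_inj; rewrite /= bc.
  have -> : \sum_c strE b c * strF c b = (b * (t - b))%:R.
    case: b => -[|b] lt /=.
      by rewrite big1 => [|c _]; rewrite ?mul0n // /strE mul0r.
    rewrite (bigD1 (Ordinal (ltnW lt))) //= /strE /strF /= eqxx !mul1r.
    rewrite big1 ?addr0 // => c; rewrite -val_eqE /= eqSS eq_sym => /negPf->.
    by rewrite mul0r.
  have -> : \sum_c strF b c * strE c b = (b.+1 * (t - b.+1))%:R.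
    have [lt|ge] := ltnP b.+1 t; last first.
      have -> : (t - b.+1 = 0)%N by lia.
      rewrite muln0 big1 // => c _; rewrite /strE.
      by rewrite (_ : (_ == _) = false) ?mulr0 //; have := ltn_ord c; lia.
    rewrite (bigD1 (Ordinal lt)) //= /strE /strF /= eqxx !mul1r mulr1.
    by rewrite big1 ?addr0 // => c; rewrite -val_eqE /= => /negPf->; rewrite mulr0.
  have lt := ltn_ord b; rewrite mulr1 !pmulrn -intrB.
  by congr (_%:~R); nia.
by have := ltn_ord b; lia.
Qed.

End String.

Section PowerTrick.

Variables (k : fieldType) (U : vectType k) (Ug : int -> {vspace U}).
Variables (l : {linear U -> U}) (J : finType) (deg : J -> int) (K : J -> J -> k).
Hypothesis lU : forall a v, v \in Ug a -> l v \in Ug (a + 1).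
Hypothesis Kdeg : forall b c, K b c != 0 -> deg b = deg c + 1.
Variable (t : nat).

Local Notation degt := (fun x : J * 'I_t => deg x.1 + x.2%:Z).
Local Notation Kt := (ksum K (@strE k t)).

Definition slice (W : {ffun J * 'I_t -> U}) (s : 'I_t) : {ffun J -> U} :=
  [ffun b => W (b, s)].

(** For W the sum of the W_s y^s, the coefficient of (L + y) W at y^s is L W_s + W_(s-1). *)
Lemma lop_slice W b s :
  lop l Kt W (b, s) = lop l K (slice W s) b + \sum_s' strE k s s' *: W (b, s').
Proof.
rewrite /lop !ffunE -addrA; congr (_ + _).
rewrite (eq_bigr (fun p => Kt (b, s) (p.1, p.2) *: W (p.1, p.2))) => [|[] //].
rewrite -(pair_bigA _ (fun c s' => Kt (b, s) (c, s') *: W (c, s'))) /=.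
under eq_bigr => c _ do under eq_bigr => s' _ do rewrite /ksum /= scalerDl.
under eq_bigr do rewrite big_split.
rewrite big_split; congr (_ + _); last first.
  rewrite (bigD1 b) //= [X in _ + X]big1 ?addr0 => [|c cb].
    by apply: eq_bigr => s' _; rewrite eqxx mul1r.
  by apply: big1 => s' _; rewrite eq_sym (negPf cb) mul0r scale0r.
apply: eq_bigr => c _; rewrite ffunE (bigD1 s) //= eqxx mulr1 big1 ?addr0 //.
by move=> s' ss'; rewrite eq_sym (negPf ss') mulr0 scale0r.
Qed.

Lemma lop_slice0 W b (s : 'I_t) : s = 0%N :> nat -> lop l Kt W (b, s) = lop l K (slice W s) b.
Proof.
by move=> s0; rewrite lop_slice big1 ?addr0 // => s' _; rewrite /strE s0 scale0r.
Qed.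

Lemma lop_sliceS W b (s s' : 'I_t) : s = s'.+1 :> nat ->
  lop l Kt W (b, s) = lop l K (slice W s) b + W (b, s').
Proof.
move=> ss'; rewrite lop_slice (bigD1 s') //= /strE ss' eqxx scale1r big1 ?addr0 //.
by move=> s''; rewrite -val_eqE eqSS eq_sym => /negPf->; rewrite scale0r.
Qed.

(* A kernel element w of L^t yields the kernel element                        *)
(* \sum_s (-1)^s L^(t-1-s) w y^s of L + y modulo y^t.                         *)
Lemma tot_inj_power i : (0 < t)%N ->
  tot_inj Ug l degt Kt (i + t%:Z - 1) 1 -> tot_inj Ug l deg K i t.
Proof.
move=> t0 injt w wi Lw0.
pose W : {ffun J * 'I_t -> U} := [ffun x : J * 'I_t =>
  (-1) ^+ x.2 *: iter (t.-1 - x.2) (lop l K) w x.1].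
have sliceW s : slice W s = (-1) ^+ s *: iter (t.-1 - s) (lop l K) w.
  by apply/ffunP => b; rewrite !ffunE.
have W0 : W = 0.
  apply: injt => [[b s]|/=].
    rewrite ffunE /= memvZ //.
    have := tot_deg_iter_lop lU Kdeg (t.-1 - s) wi b.
    by congr (_ \in Ug _); have := ltn_ord s; lia.
  apply/ffunP => -[b s]; rewrite [RHS]ffunE.
  case: s => -[|s] lts.
    rewrite lop_slice0 // sliceW expr0 scale1r subn0 -iterS prednK // Lw0.
    by rewrite ffunE.
  rewrite (@lop_sliceS _ _ _ (Ordinal (ltnW lts))) // sliceW linearZ /=.
  rewrite -iterS (_ : (t.-1 - s.+1).+1 = t.-1 - s)%N; last by lia.
  rewrite !ffunE /=.
  by rewrite exprS mulN1r scaleNr addNr.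
have lt : (t.-1 < t)%N by rewrite prednK.
apply/ffunP => b; move/ffunP: W0 => /(_ (b, Ordinal lt)); rewrite !ffunE /= subnn /=.
by move/eqP; rewrite scaler_eq0 signr_eq0 /= => /eqP.
Qed.

(** Lift w y^0 to W under L + y. Comparing coefficients, w = L W_0 and W_s = - L W_(s+1), so w is up
    to sign L^t W_(t-1). *)
Lemma tot_surj_power i : (0 < t)%N ->
  tot_surj Ug l degt Kt (i + t%:Z - 1) 1 -> tot_surj Ug l deg K i t.
Proof.
move=> t0 surjt w wi.
pose w' : {ffun J * 'I_t -> U} := [ffun x : J * 'I_t => if x.2 == 0%N :> nat then w x.1 else 0].
have [[b s]|W Wi /= w'W] := surjt w'.
  rewrite ffunE /=; case: eqP => [->|_]; last by rewrite mem0v.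
  by have := wi b; congr (_ \in Ug _); lia.
have wW (s : nat) (lts : (s < t)%N) :
    w = (-1) ^+ s *: iter s.+1 (lop l K) (slice W (Ordinal lts)).
  elim: s lts => [|s IHs] lts.
    rewrite expr0 scale1r; apply/ffunP => b; rewrite -lop_slice0 //.
    by rewrite -w'W ffunE.
  rewrite (IHs (ltnW lts)).
  have -> : slice W (Ordinal (ltnW lts)) = - lop l K (slice W (Ordinal lts)).
    apply/eqP; rewrite -addr_eq0 addrC; apply/eqP/ffunP => b.
    rewrite ffunE [slice _ _ b]ffunE -(@lop_sliceS _ _ _ (Ordinal (ltnW lts))) //.
    by rewrite -w'W !ffunE.
  by rewrite iter_linearN -iterSr exprS mulN1r scaleNr scalerN.
have lt : (t.-1 < t)%N by rewrite prednK.
exists ((-1) ^+ t.-1 *: slice W (Ordinal lt)).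
  apply: tot_degZ => b; rewrite ffunE; have := Wi (b, Ordinal lt).
  by congr (_ \in Ug _) => /=; lia.
by rewrite iter_linearZ {1}(wW t.-1 lt) prednK.
Qed.

End PowerTrick.

(** Adjoining y replaces N by N + t - 1 and the degree i by i + t - 1, so L^t in degree i is
    governed by the antidiagonal 2i + t - N of l. *)
Lemma lefschetz_power (k : fieldType) (k0 : [pchar k] =i pred0)
    (U : vectType k) (Ug : int -> {vspace U}) (l : {linear U -> U})
    (J : finType) (deg : J -> int) N (E F : J -> J -> k) :
  (forall a v, v \in Ug a -> l v \in Ug (a + 1)) ->
  sl2_data deg N E F ->
  (forall e, inj_sum Ug l e \/ surj_sum Ug l e) ->
  forall i t, (0 < t)%N -> tot_inj Ug l deg E i t \/ tot_surj Ug l deg E i t.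
Proof.
move=> lU EF Q i t t0; have dE := let: And4 dE _ _ _ := EF in dE.
have EFt := sl2_ksum EF (sl2_string k t).
have [inj|surj] := Q (2 * (i + t%:Z - 1) + 1 - (N + (t%:Z - 1))).
  by left; apply: tot_inj_power => //; apply: (tot_inj1 k0 EFt inj).
by right; apply: tot_surj_power => //; apply: (tot_surj1 k0 lU EFt surj).
Qed.

(** * The sl2-action on a monomial complete intersection *)

Section MonomialCI.

Variables (k : fieldType) (n : nat) (d : 'I_n -> nat).
Hypothesis d_gt0 : forall i, (0 < d i)%N.

Local Notation box := {dffun forall i, 'I_(d i)}.
Local Notation B := (monomial_ci_type k d_gt0).
Local Notation proj := (@mci_proj k n d d_gt0).

Definition box_deg (b : box) : int := (mdeg (box_mnm b))%:Z.

Definition mci_mon (b : box) : B := proj 'X_[box_mnm b].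

Definition mul_kernel (u : B) (b c : box) : k := (u * mci_mon c) b.

Lemma mci_monE b c : mci_mon b c = (b == c)%:R.
Proof. by rewrite ffunE mcoeffX (inj_eq (@box_mnm_inj n d)). Qed.

Lemma mci_mon_sum (u : B) : u = \sum_b u b *: mci_mon b.
Proof. by rewrite -{1}[u]mci_liftK linear_sum; apply: eq_bigr => b _; rewrite linearZ. Qed.

Lemma mul_kernel_sum u v b : (u * v : B) b = \sum_c mul_kernel u b c * v c.
Proof.
rewrite {1}[v]mci_mon_sum mulr_sumr sum_ffunE; apply: eq_bigr => c _.
by rewrite -scalerAr ffunE mulrC.
Qed.

Definition mci_ell : B := proj (\sum_i 'X_i).

(** The i-th summand sends x_i^a to a (d_i - a) x_i^(a-1), the lowering operator of a string of
    length d_i. It is defined on polynomials, where the product rule is available, and passes to the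
    quotient by [lower_proj0]. *)
Definition lower_poly (p : {mpoly k[n]}) : {mpoly k[n]} :=
  \sum_i ((d i)%:R *: mderiv i p - mderiv i ('X_i * mderiv i p)).

Fact lower_poly_linear : linear lower_poly.
Proof.
move=> c p q; rewrite /lower_poly scaler_sumr -big_split; apply: eq_bigr => i _ /=.
by rewrite !(mderivD, mderivZ, mulrDr) -scalerAr mderivZ -!mul_mpolyC; ring.
Qed.

HB.instance Definition _ :=
  GRing.isLinear.Build k {mpoly k[n]} {mpoly k[n]} _ lower_poly lower_poly_linear.

Lemma mcoeff_euler i (p : {mpoly k[n]}) m : ('X_i * mderiv i p)@_m = p@_m *+ m i.
Proof.
elim/mpolyind: p => [|c m' p _ _ IH]; first by rewrite mderiv0 mulr0 mcoeff0 mul0rn.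
rewrite mderivD mulrDr !mcoeffD mulrnDl IH; congr (_ + _).
rewrite mderivZ mderivX -!scalerAr !mcoeffZ -mpolyXD.
have [mi0|mi0] := eqVneq (m' i) 0%N.
  rewrite mi0 mul0r mulr0 mcoeffX; case: eqP => [<-|_]; rewrite ?mi0 //.
  by rewrite mulr0 mul0rn.
rewrite addmC submK; last by apply/mnm_lepP => j; rewrite mnm1E; case: eqP => // <-; rewrite lt0n.
rewrite mcoeffX; case: eqP => [<-|_]; last by rewrite !mulr0 mul0rn.
by rewrite !mulr1 mulr_natr.
Qed.

Lemma mcoeff_lower p m : (lower_poly p)@_m =
  \sum_i p@_(m + U_(i)) * ((m i).+1%:R * ((d i)%:R - (m i).+1%:R)).
Proof.
rewrite linear_sum; apply: eq_bigr => i _ /=.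
rewrite mcoeffB mcoeffZ !mcoeff_deriv mcoeff_euler mnmDE mnm1E eqxx addn1.
rewrite -[p@__ *+ _]mulr_natr -[_ *+ _ in X in _ - X]mulr_natr.
move: (_.+1%:R : k) ((d i)%:R : k) (p@__) => s e x; ring.
Qed.

(** A monomial outside the box could enter it only by lowering an exponent from d_i to d_i - 1, and
    there the coefficient has the factor d_i - d_i. *)
Lemma lower_proj0 p : proj p = 0 -> proj (lower_poly p) = 0.
Proof.
move=> p0; apply/ffunP => b; rewrite !ffunE mcoeff_lower big1 // => i _.
have [bi|bi] := ltnP (b i).+1 (d i); last first.
  by rewrite mnmE (_ : (b i).+1 = d i) ?subrr ?mulr0 //; have := ltn_ord (b i); lia.
have [|c bc] := @box_mnm_ex n d (box_mnm b + U_(i)).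
  move=> j; rewrite mnmDE mnm1E mnmE; case: eqP => [<-|_]; rewrite ?addn1 //.
  by rewrite addn0.
by move/ffunP: p0 => /(_ c); rewrite !ffunE -bc => ->; rewrite mul0r.
Qed.

(** On a monomial x^m the right-hand side is multiplication by the sum of the 2 m_i - (d_i - 1),
    which is its weight. *)
Lemma lower_comm p : (\sum_i 'X_i) * lower_poly p - lower_poly ((\sum_i 'X_i) * p)
  = \sum_i (('X_i * mderiv i p) *+ 2 - (d i)%:R *: p + p).
Proof.
rewrite [X in _ - lower_poly X]mulr_suml [lower_poly (\sum__ _)]linear_sum.
rewrite mulr_suml -sumrB; apply: eq_bigr => i _.
rewrite /= /lower_poly mulr_sumr -sumrB (bigD1 i) //= big1 ?addr0; last first.
  move=> j ji; have Dx : mderiv j 'X_i = 0 :> {mpoly k[n]}.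
    by rewrite mderivX mnm1E eq_sym (negPf ji) scale0r.
  by rewrite !(mderivM, Dx, mderivD, mul0r, add0r) -!mul_mpolyC; ring.
have Dx : mderiv i 'X_i = 1 :> {mpoly k[n]}.
  by rewrite mderivX mnm1E eqxx scale1r (_ : _ - _ = 0)%MM ?mpolyX0 //;
     apply/mnmP => j; rewrite mnmBE subnn mnm0E.
rewrite !(mderivM, Dx, mderivD, mul1r) -!mul_mpolyC; ring.
Qed.

Definition lower_kernel (b c : box) : k := proj (lower_poly 'X_[box_mnm c]) b.

Lemma lower_kernel_sum p b : proj (lower_poly p) b = \sum_c lower_kernel b c * proj p c.
Proof.
have -> : proj (lower_poly p) = proj (lower_poly (mci_lift (proj p))).
  have : proj (lower_poly (p - mci_lift (proj p))) = 0.
    by apply: lower_proj0; rewrite linearB /= mci_liftK subrr.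
  by rewrite !linearB /= => /eqP; rewrite subr_eq0 => /eqP.
rewrite /mci_lift [lower_poly _]linear_sum linear_sum sum_ffunE.
apply: eq_bigr => c _.
by rewrite /= [lower_poly _]linearZ /= linearZ /= ffunE mulrC.
Qed.

Lemma mci_homog_coef q (p : {mpoly k[n]}) b : p \is q.-homog -> proj p b != 0 ->
  mdeg (box_mnm b) = q.
Proof.
move=> ph; rewrite ffunE; apply: contraNeq => bq; apply/eqP.
exact: dhomog_nemf_coeff ph bq.
Qed.

Lemma mci_comp_coef q (u : B) b : u \in gcomp (monomial_ci k d_gt0) q -> u b != 0 ->
  mdeg (box_mnm b) = q.
Proof. by move=> /image_compP[p ph ->]; apply: mci_homog_coef ph. Qed.

Lemma mci_mon_comp b : mci_mon b \in gcomp (monomial_ci k d_gt0) (mdeg (box_mnm b)).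
Proof. by apply/image_compP; exists 'X_[box_mnm b] => //; rewrite dhomogX. Qed.

Lemma mul_kernel_deg u b c : u \in gcomp (monomial_ci k d_gt0) 1 ->
  mul_kernel u b c != 0 -> box_deg b = box_deg c + 1.
Proof.
move=> /image_compP[p ph ->]; rewrite /mul_kernel /mci_mon -rmorphM /=.
have pXh : p * 'X_[box_mnm c] \is (1 + mdeg (box_mnm c)).-homog.
  by rewrite dhomogM // dhomogX.
by move/(mci_homog_coef pXh); rewrite /box_deg; lia.
Qed.

Lemma mci_ell_comp : mci_ell \in gcomp (monomial_ci k d_gt0) 1.
Proof.
apply/image_compP; exists (\sum_i 'X_i) => //.
by apply: rpred_sum => i _; rewrite dhomogX /= mdeg1.
Qed.

Lemma lower_kernel_deg b c : lower_kernel b c != 0 -> box_deg b = box_deg c - 1.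
Proof.
rewrite /lower_kernel ffunE mcoeff_lower => nz.
have [i /=] : exists i, (box_mnm c == box_mnm b + U_(i))%MM.
  apply/existsP; apply: contraNT nz; rewrite negb_exists => /forallP nz.
  by rewrite big1 // => i _; rewrite mcoeffX (negPf (nz i)) mul0r.
by move=> /eqP e; rewrite /box_deg e mdegD mdeg1; lia.
Qed.

Lemma sl2_mci :
  sl2_data box_deg (\sum_i (d i).-1)%N%:Z (mul_kernel mci_ell) lower_kernel.
Proof.
split.
- by move=> b c; apply: mul_kernel_deg mci_ell_comp.
- exact: lower_kernel_deg.
- move=> b b'; pose X := 'X_[box_mnm b'] : {mpoly k[n]}.
  have -> : \sum_c (mul_kernel mci_ell b c * lower_kernel c b'
                    - lower_kernel b c * mul_kernel mci_ell c b')
     = proj ((\sum_i 'X_i) * lower_poly X - lower_poly ((\sum_i 'X_i) * X)) b.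
    have subE (f g : B) : (f - g) b = f b - g b by rewrite !ffunE.
    rewrite sumrB linearB /= subE lower_kernel_sum rmorphM.
    by rewrite mul_kernel_sum; congr (_ - _); apply: eq_bigr => c _; rewrite rmorphM.
  rewrite lower_comm ffunE linear_sum /= .
  under eq_bigr => i _ do rewrite mcoeffD mcoeffB mcoeffMn mcoeff_euler mcoeffZ.
  rewrite mcoeffX (inj_eq (@box_mnm_inj n d)) eq_sym.
  have [->|_] := eqVneq b b'; last first.
    by rewrite mulr0 big1 // => i _; rewrite !mul0rn mulr0 subr0 addr0.
  rewrite mulr1 /box_deg mdegE.
  have -> : (2 * (\sum_i box_mnm b' i)%N%:Z - (\sum_i (d i).-1)%N%:Z)
          = \sum_i ((box_mnm b' i)%:Z *+ 2 - (d i)%:Z + 1).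
    rewrite -!natz !natr_sum mulr_sumr -sumrB; apply: eq_bigr => i _.
    by have := d_gt0 i; rewrite !natz; lia.
  rewrite rmorph_sum; apply: eq_bigr => i _.
  by rewrite /= intrD intrB mulr1; congr (_ - _ + _); rewrite -mulrnA pmulrn; congr (_%:~R); lia.
- move=> b; rewrite /box_deg; apply/andP; split; first by [].
  rewrite lez_nat mdegE leq_sum // => i _.
  by rewrite mnmE -ltnS prednK.
Qed.

End MonomialCI.

(** * Coordinates on the tensor product *)

Definition gz (k : fieldType) (A : gradedAlg k) (a : int) : {vspace A} :=
  if a is Posz i then gcomp A i else 0%VS.

Lemma gz_mul (k : fieldType) (A : gradedAlg k) (l : A) :
  l \in gcomp A 1 -> forall a v, v \in gz A a -> amull l v \in gz A (a + 1).
Proof.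
move=> l1 [i|i] v.
  move=> vi; have -> : i%:Z + 1 = (1 + i)%N by lia.
  rewrite lfunE /=.
  by apply: (subvP (gcompM A 1 i)); rewrite memv_mul.
by rewrite /gz memv0 => /eqP->; rewrite linear0 mem0v.
Qed.

Lemma hilb_gz (k : fieldType) (A : gradedAlg k) a : hilb A a = \dim (gz A a).
Proof. by case: a => //= i; rewrite dimv0. Qed.

Lemma image_comp0 (k : fieldType) (B : falgType k) n
    (rho : {lrmorphism {mpoly k[n]} -> B}) b :
  b \in image_comp rho 0 -> exists c, b = c *: 1.
Proof.
move=> /image_compP[p ph ->]; exists p@_0.
have {1}-> : p = p@_0 *: 1.
  apply/mpolyP => m; rewrite mcoeffZ mcoeff1.
  have [->|m0] := eqVneq m 0%MM; first by rewrite mulr1.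
  by rewrite mulr0 (dhomog_nemf_coeff ph) // mdeg_eq0.
by rewrite linearZ /= rmorph1.
Qed.

Section TensLinear.

Variables (k : fieldType) (A B : falgType k).

Lemma tens0l (b : B) : tens (0 : A) b = 0.
Proof. by have := tensP (-1) 0 (0 : A) b; rewrite scaler0 addr0 scaleN1r addNr. Qed.

Lemma tens0r (a : A) : tens a (0 : B) = 0.
Proof. by have := tensPr (-1) a 0 (0 : B); rewrite scaler0 addr0 scaleN1r addNr. Qed.

Lemma tensZl c (a : A) (b : B) : tens (c *: a) b = c *: tens a b.
Proof. by have := tensP c a 0 b; rewrite tens0l !addr0. Qed.

Lemma tensZr c (a : A) (b : B) : tens a (c *: b) = c *: tens a b.
Proof. by have := tensPr c a b 0; rewrite tens0r !addr0. Qed.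

Lemma tens_sumr (a : A) (I : finType) (c : I -> k) (v : I -> B) :
  tens a (\sum_i c i *: v i) = \sum_i tens (c i *: a) (v i).
Proof.
have tD (x y : B) : tens a (x + y) = tens a x + tens a y.
  by have := tensPr 1 a x y; rewrite !scale1r.
rewrite (big_morph (tens a) tD (tens0r a)); apply: eq_bigr => i _.
by rewrite tensZl tensZr.
Qed.

End TensLinear.

Section Transfer.

Variables (k : fieldType) (A : gradedAlg k).
Variables (n : nat) (d : 'I_n -> nat) (d_gt0 : forall i, (0 < d i)%N).

Local Notation box := {dffun forall i, 'I_(d i)}.
Local Notation B := (monomial_ci k d_gt0).
Local Notation T := (tensor A B).
Local Notation tens := (@tens k A B).
Local Notation mon := (@mci_mon k n d d_gt0).

Definition coef_pair (b : box) (a : A) (v : B) : A := (v : monomial_ci_type k d_gt0) b *: a.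

Lemma coef_pair_bilin b : bilin (coef_pair b).
Proof.
split=> [v|a] c x y; rewrite /coef_pair; first by rewrite scalerDr !scalerA mulrC.
by rewrite !ffunE scalerDl scalerA.
Qed.

(** Coordinates in the monomial basis of B identify A (x) B with the A-valued functions on the box;
    multiplication by l (x) 1 + 1 (x) u becomes a [lop] ([tmap_mul]). *)
Definition tmap (M : T) : {ffun box -> A} := [ffun b => tens_lift (coef_pair b) M].

Fact tmap_linear : linear tmap.
Proof. by move=> c x y; apply/ffunP => b; rewrite !ffunE linearP. Qed.

HB.instance Definition _ :=
  GRing.isLinear.Build k T {ffun box -> A} _ tmap tmap_linear.

Definition tmap_inv (w : {ffun box -> A}) : T := \sum_b tens (w b) (mon b).

Lemma tmapE a (v : B) b : tmap (tens a v) b = (v : monomial_ci_type k d_gt0) b *: a.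
Proof. by rewrite ffunE tens_liftE //; apply: coef_pair_bilin. Qed.

Lemma tmap_invK : cancel tmap_inv tmap.
Proof.
move=> w; apply/ffunP => b; rewrite linear_sum sum_ffunE (bigD1 b) //=.
rewrite tmapE mci_monE eqxx scale1r big1 ?addr0 // => c /negPf.
by rewrite tmapE mci_monE eq_sym => ->; rewrite scale0r.
Qed.

Fact tmap_inv_linear : linear tmap_inv.
Proof.
move=> c x y; rewrite /tmap_inv scaler_sumr -big_split; apply: eq_bigr => b _.
by rewrite !ffunE tensP.
Qed.

HB.instance Definition _ :=
  GRing.isLinear.Build k {ffun box -> A} T _ tmap_inv tmap_inv_linear.

Lemma tmapK : cancel tmap tmap_inv.
Proof.
move=> M; apply: (@tens_lift_uniq k A B _ (tmap_inv \o tmap) idfun) => a v /=.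
rewrite [v in RHS](mci_mon_sum v) tens_sumr; apply: eq_bigr => b _.
by rewrite tmapE.
Qed.

Definition tform (l : A) (u : B) : T := tens l 1 + tens 1 u.

Lemma tmap_mul l u M : tmap (tform l u * M)
  = lop (amull l) (mul_kernel (u : monomial_ci_type k d_gt0)) (tmap M).
Proof.
have -> : tform l u * M = amull (tform l u) M by rewrite lfunE.
apply: (@tens_lift_uniq k A B _ (tmap \o amull (tform l u))
  (lop (amull l) (mul_kernel (u : monomial_ci_type k d_gt0)) \o tmap)) => a v /=.
rewrite lfunE /= mulrDl !tensM !mul1r; apply/ffunP => b.
rewrite linearD /lop !ffunE -!/(tens _ _); congr (_ + _).
  rewrite tens_liftE; last exact: coef_pair_bilin.
  rewrite tens_liftE; last exact: coef_pair_bilin.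
  rewrite /coef_pair linearZ. by rewrite /= lfunE.
rewrite tens_liftE; last exact: coef_pair_bilin.
rewrite /coef_pair mul_kernel_sum scaler_suml; apply: eq_bigr => c _.
by rewrite tmapE scalerA.
Qed.

Lemma tmap_iter l u t M : tmap (tform l u ^+ t * M)
  = iter t (lop (amull l) (mul_kernel (u : monomial_ci_type k d_gt0))) (tmap M).
Proof.
by elim: t => [|t IH]; rewrite ?expr0 ?mul1r // exprS -mulrA tmap_mul IH.
Qed.

Lemma tmap_comp (i : nat) M :
  reflect (tot_deg (gz A) (@box_deg n d) i%:Z (tmap M)) (M \in gcomp T i).
Proof.
apply: (iffP idP) => [Mi b|Mi].
  have /subvP/(_ M Mi) : (tensor_comp A B i <=
     (linfun (tens_lift (coef_pair b))) @^-1: gz A (i%:Z - box_deg b))%VS.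
    apply: tensor_comp_ind => p q a v pq ap vq; rewrite -memv_preim lfunE /=.
    rewrite tens_liftE; last exact: coef_pair_bilin.
    rewrite /coef_pair; have [->|/(mci_comp_coef vq) bq] := eqVneq ((v : monomial_ci_type k d_gt0) b) 0.
      by rewrite scale0r mem0v.
    by rewrite /box_deg bq memvZ // -pq PoszD addrK.
  by rewrite -memv_preim lfunE ffunE.
rewrite -[M]tmapK; apply: rpred_sum => b _; have := Mi b.
case E : (i%:Z - box_deg b) => [p|p] /=; last first.
  rewrite memv0 => /eqP ->.
  by rewrite tens0l mem0v.
move=> bp; have -> : i = (p + mdeg (box_mnm b))%N by move: E; rewrite /box_deg; lia.
exact: (mem_tensor_comp bp (mci_mon_comp k d_gt0 b)).
Qed.

Lemma full_rankP l u (i t : nat) :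
  l \in gcomp A 1 -> u \in gcomp B 1 ->
  mul_full_rank (A := T) (tform l u) i t <->
  tot_inj (gz A) (amull l) (@box_deg n d) (mul_kernel (u : monomial_ci_type k d_gt0)) i%:Z t \/
  tot_surj (gz A) (amull l) (@box_deg n d) (mul_kernel (u : monomial_ci_type k d_gt0)) i%:Z t.
Proof.
move=> l1 u1.
have tmap_inj := can_inj tmapK.
split=> -[H|H]; [left|right|left|right].
- move=> w wi Lw0; rewrite -[w]tmap_invK; move: wi Lw0; rewrite -[w]tmap_invK.
  move: (tmap_inv w) => M /tmap_comp Mi; rewrite -tmap_iter => M0.
  rewrite tmapK; suff -> : M = 0 by rewrite linear0.
  by apply: H; rewrite ?mem0v // mulr0; apply: tmap_inj; rewrite M0 linear0.
- move=> w; rewrite -[w]tmap_invK -PoszD => /tmap_comp.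
  rewrite -H => /memv_imgP[M Mi ->]; exists (tmap M); first exact/tmap_comp.
  by rewrite lfunE /= tmap_iter.
- move=> M M' Mi M'i MM'; apply/eqP; rewrite -subr_eq0; apply/eqP/tmap_inj.
  rewrite [RHS]linear0; apply: H; first by apply/tmap_comp; rewrite rpredB.
  by rewrite -tmap_iter mulrBr MM' subrr linear0.
apply/eqP; rewrite eqEsubv; apply/andP; split.
  apply/subvP => _ /memv_imgP[M /tmap_comp Mi ->]; rewrite lfunE /=; apply/tmap_comp.
  rewrite tmap_iter PoszD; apply: tot_deg_iter_lop => //; first exact: gz_mul.
  by move=> b c; apply: mul_kernel_deg.
apply/subvP => M /tmap_comp; rewrite PoszD => /H[w wi Mw].
apply/memv_imgP; exists (tmap_inv w); first by apply/tmap_comp; rewrite tmap_invK.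
by apply: tmap_inj; rewrite lfunE /= tmap_iter tmap_invK.
Qed.

Lemma tform_comp l u : l \in gcomp A 1 -> u \in gcomp B 1 -> tform l u \in gcomp T 1.
Proof.
move=> l1 u1; rewrite rpredD //.
  exact: (mem_tensor_comp l1 (gcomp1 B)).
exact: (mem_tensor_comp (gcomp1 A) u1).
Qed.

(** Degree one of A (x) B is A_1 (x) B_0 + A_0 (x) B_1, and A_0 and B_0 consist of scalars. *)
Lemma tform_ex (z : T) : (forall a, a \in gcomp A 0 -> exists c, a = c *: 1) ->
  z \in gcomp T 1 ->
  exists l u, [/\ l \in gcomp A 1, u \in gcomp B 1 & z = tform l u].
Proof.
move=> A0.
pose fl := HB.pack_for {linear A -> T} (fun l : A => tens l 1)
  (GRing.isLinear.Build _ _ _ _ (fun l : A => tens l 1) (fun c a a' => tensP c a a' (1 : B))).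
pose fr := HB.pack_for {linear B -> T} (fun u : B => tens 1 u)
  (GRing.isLinear.Build _ _ _ _ (fun u : B => tens 1 u) (fun c a a' => tensPr c (1 : A) a a')).
have flE x : linfun fl x = tens x 1 := lfunE fl x.
have frE x : linfun fr x = tens 1 x := lfunE fr x.
move=> z1; have : z \in (linfun fl @: gcomp A 1 + linfun fr @: gcomp B 1)%VS.
  have /subvP : (tensor_comp A B 1 <= linfun fl @: gcomp A 1 + linfun fr @: gcomp B 1)%VS.
    apply: tensor_comp_ind => p q a v; case: p => [|[|p]] //=; case: q => [|[|q]] //= _.
      move=> /A0[c ->] v1; apply: (subvP (addvSr _ _)).
      apply/memv_imgP; exists (c *: v); first by rewrite memvZ.
      by rewrite frE tensZl tensZr.
    move=> a1 /image_comp0[c ->]; apply: (subvP (addvSl _ _)).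
    apply/memv_imgP; exists (c *: a); first by rewrite memvZ.
    by rewrite flE tensZl tensZr.
  exact.
move=> /memv_addP[_ /memv_imgP[l l1 ->] [_ /memv_imgP[u u1 ->] ->]].
by exists l, u; rewrite flE frE.
Qed.

End Transfer.

(** * Counting arguments *)

(** The coefficients on P1 are the unknowns and the vanishing on P2 gives the equations, of which
    there are fewer. *)
Lemma underdetermined_system (k : fieldType) (J : finType)
    (f : {linear {ffun J -> k^o} -> {ffun J -> k^o}}) (P1 P2 : pred J) :
  (#|P2| < #|P1|)%N ->
  exists al : {ffun J -> k^o}, [/\ al != 0, forall b, ~~ P1 b -> al b = 0
    & forall b, P2 b -> f al b = 0].
Proof.
move=> lt12.
pose dl (c : J) : {ffun J -> k^o} := [ffun b => (b == c)%:R].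
pose M : 'M[k]_(#|P1|, #|P2|) := \matrix_(p, q) f (dl (enum_val p)) (enum_val q).
have : kermx M != 0.
  by rewrite -mxrank_eq0 mxrank_ker -lt0n subn_gt0 (leq_ltn_trans (rank_leq_col M)).
case/rowV0Pn => v /sub_kermxP vM v0.
exists (\sum_p v 0 p *: dl (enum_val p)); split.
- apply: contraNneq v0 => /ffunP al0; apply/eqP/rowP => p.
  move: (al0 (enum_val p)); rewrite sum_ffunE (bigD1 p) //= !ffunE eqxx.
  rewrite big1 ?addr0 => [|q qp].
    by rewrite /GRing.scale /= mulr1 mxE => ->.
  by rewrite !ffunE (inj_eq enum_val_inj) eq_sym (negPf qp) scaler0.
- move=> b nb; rewrite sum_ffunE big1 // => p _; rewrite !ffunE.
  case: eqP => [bp|_]; last by rewrite scaler0.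
  by case/negP: nb; rewrite bp; have := enum_valP p.
move=> b Pb; rewrite linear_sum sum_ffunE.
move/rowP: vM => /(_ (enum_rank_in (Pb : b \in P2) b)); rewrite !mxE => vMb; rewrite -[RHS]vMb.
by apply: eq_bigr => p _; rewrite linearZ ffunE mxE enum_rankK_in.
Qed.

Lemma separating_functional (k : fieldType) (U : vectType k) (W : {vspace U}) v :
  v \notin W -> exists2 la : {linear U -> k^o}, (forall x, x \in W -> la x = 0) & la v != 0.
Proof.
move=> vW; pose g : 'End(U) := (\1 - projv W)%VF.
have gv : g v != 0.
  rewrite /g add_lfunE opp_lfunE id_lfunE subr_eq0; apply: contraNneq vW => ->.
  exact: memv_proj.
have /existsP[i iv] : [exists i, coord (vbasis {:U}) i (g v) != 0].
  apply: contraNT gv; rewrite negb_exists => /forallP c0.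
  rewrite [g v](coord_vbasis (memvf _)) big1 // => i _.
  by have := c0 i; rewrite negbK => /eqP ->; rewrite scale0r.
exists (coord (vbasis {:U}) i \o g) => //= x xW.
by rewrite /g add_lfunE opp_lfunE id_lfunE projv_id // subrr linear0.
Qed.

Section Counting.

Variables (k : fieldType) (U : vectType k) (Ug : int -> {vspace U}).
Variable (l : {linear U -> U}).
Hypothesis lU : forall a v, v \in Ug a -> l v \in Ug (a + 1).
Variables (J : finType) (deg : J -> int) (K : J -> J -> k).
Hypothesis Kdeg : forall b c, K b c != 0 -> deg b = deg c + 1.

Definition deg_count (x y : int) : nat := #|[pred b | (x < deg b <= y)%R]|.

Lemma iter_deg (m : nat) a x : x \in Ug a -> iter m l x \in Ug (a + m%:Z).
Proof.
move=> xa; elim: m => [|m IH] /=; first by rewrite addr0.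
by rewrite (_ : a + m.+1%:Z = a + m%:Z + 1); [apply: lU | lia].
Qed.

(** If l^m v = 0 with v nonzero, take the least mu with l^mu v = 0. The l^p v (x) b with p < mu span
    an L-stable subspace whose dimensions in degrees i and i + t are the two counts, so L^t has a
    kernel there. As mu is not known in advance, all values up to m are assumed. *)
Lemma count_inj (i a : int) (t m : nat) :
  tot_inj Ug l deg K i t ->
  (forall mu : nat, (0 < mu <= m)%N ->
    (deg_count (i - a - mu%:Z + t%:Z)%R (i - a + t%:Z)%R
       < deg_count (i - a - mu%:Z)%R (i - a)%R)%N) ->
  inj_at Ug l a m.
Proof.
move=> injL lt v va vm; apply/eqP/contraT => v0.
have exmu : exists mu, iter mu l v == 0 by exists m; apply/eqP.
case: (ex_minnP exmu) => mu /eqP vmu mu_min.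
have mu0 : (0 < mu)%N by rewrite lt0n; apply: contraNneq v0 => mu0; rewrite -vmu mu0.
have mum : (mu <= m)%N by apply: mu_min; rewrite vm.
(* In a given total degree the exponent of l is determined by deg b, so on coefficients L acts
   simply as 1 + K. *)
pose f s := iter s (lop (U := k^o) idfun K).
have [al [al0 alP1 alP2]] := @underdetermined_system k J (iter t (lop (U := k^o) idfun K)) _ _ (lt mu (introT andP (conj mu0 mum))).
set j := i - a in alP1 alP2.
(* The default 0 for a negative exponent does no harm: by [f_high] the coefficient vanishes
   there. *)
pose vv z := if z is Posz p then iter p l v else 0.
pose W (s : nat) : {ffun J -> U} := [ffun b => f s al b *: vv (j + s%:Z - deg b)].
have fS s b : f s.+1 al b = f s al b + \sum_c K b c * f s al c.
  by rewrite /f /= lopE.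
have f_high s b : j + s%:Z < deg b -> f s al b = 0.
  elim: s b => [|s IHs] b ltb; first by apply: alP1; rewrite /=; lia.
  rewrite fS IHs ?add0r; last by lia.
  apply: big1 => c _; have [->|/Kdeg dbc] := eqVneq (K b c) 0; first by rewrite mul0r.
  by rewrite IHs ?mulr0 //; lia.
have lvv z : 0 <= z -> l (vv z) = vv (z + 1) by case: z => // p _; rewrite /= addn1.
have WE s b : W s b = f s al b *: vv (j + s%:Z - deg b) by rewrite ffunE.
have WS s : lop l K (W s) = W s.+1.
  apply/ffunP => b; rewrite lopE !WE fS scalerDl linearZ /=; congr (_ + _).
    have [zge|zlt] := leP (deg b) (j + s%:Z).
      rewrite lvv; last by lia.
      by congr (_ *: vv _); lia.
    by rewrite f_high // !scale0r.
  rewrite scaler_suml; apply: eq_bigr => c _; rewrite WE scalerA.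
  have [->|/Kdeg ->] := eqVneq (K b c) 0; first by rewrite !mul0r !scale0r.
  by congr (_ *: vv _); lia.
have iterW s : iter s (lop l K) (W 0%N) = W s by elim: s => //= s ->; rewrite WS.
have W0i : tot_deg Ug deg i (W 0%N).
  move=> b; rewrite WE memvZ // addr0.
  case E : (j - deg b) => [p|p] /=; last exact: mem0v.
  by have := iter_deg p va; congr (_ \in Ug _); rewrite -E /j; lia.
have : W 0%N = 0.
  apply: injL W0i _; rewrite iterW; apply/ffunP => b; rewrite WE [RHS]ffunE.
  case E : (j + t%:Z - deg b) => [p|p] /=; last by rewrite scaler0.
  have [ltp|gep] := ltnP p mu; last first.
    by rewrite -(subnK gep) iterD vmu iter_linear0 scaler0.
  by rewrite alP2 ?scale0r //= ; lia.
move/ffunP => Wb0; case/eqP: al0; apply/ffunP => b; rewrite [RHS]ffunE.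
case Pb : (j - mu%:Z < deg b <= j); last by apply: alP1; rewrite /= Pb.
move: (Wb0 b); rewrite WE ffunE addr0 => /eqP; rewrite scaler_eq0 => /orP[/eqP //|].
case E : (j - deg b) => [p|p] /=; last by lia.
by move/mu_min; lia.
Qed.

(** The dual of [count_inj]: v is replaced by a functional [la] that kills l^m U_a but not v, and
    the span of the l^p v by that of the functionals la o l^p. The count yields a nonzero functional
    in degree i + t that vanishes on the image of L^t. *)
Lemma count_surj (i a : int) (t m : nat) :
  tot_surj Ug l deg K i t ->
  (forall mu : nat, (0 < mu <= m)%N ->
    (deg_count (i - a - m%:Z - 1)%R (i - a - m%:Z + mu%:Z - 1)%R
       < deg_count (i + t%:Z - a - m%:Z - 1)%R (i + t%:Z - a - m%:Z + mu%:Z - 1)%R)%N) ->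
  surj_at Ug l a m.
Proof.
move=> surjL lt v va.
pose lm := linfun (iter m l).
have lmE x : lm x = iter m l x by rewrite lfunE.
have [/memv_imgP[u ua ->]|vW] := boolP (v \in (lm @: Ug a)%VS).
  by exists u => //; rewrite lmE.
have [la laW la_v] := separating_functional vW.
exfalso.
pose a' := a + m%:Z.
pose r0 := i + t%:Z - a'.
(* [bad p] says that la o l^p is nonzero on degree a' - p. Testing it on a basis makes it a boolean,
   so that a least mu with [~~ bad mu] can be taken. *)
pose bad p := [exists j : 'I_(\dim (Ug (a' - p%:Z))), la (iter p l (vbasis (Ug (a' - p%:Z)))`_j) != 0].
have badPn p : ~~ bad p -> forall x, x \in Ug (a' - p%:Z) -> la (iter p l x) = 0.
  rewrite negb_exists => /forallP z x xU; rewrite (coord_vbasis xU).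
  rewrite !linear_sum big1 // => j _; rewrite /= iter_linearZ linearZ /=.
  by have := z j; rewrite negbK => /eqP ->; rewrite scaler0.
have badP p : bad p -> exists2 x, x \in Ug (a' - p%:Z) & la (iter p l x) != 0.
  case/existsP => j nz; exists (vbasis (Ug (a' - p%:Z)))`_j => //.
  by rewrite vbasis_mem // mem_nth // size_tuple.
have notbadP p : (forall x, x \in Ug (a' - p%:Z) -> la (iter p l x) = 0) -> ~~ bad p.
  by move=> z; apply/negP => /badP[x xU]; rewrite z ?eqxx.
have notbad_m : ~~ bad m.
  apply: notbadP => x; rewrite (_ : a' - m%:Z = a) => [xa|]; last by rewrite /a'; lia.
  by rewrite -lmE; apply: laW; rewrite memv_img.
have exmu : exists mu, ~~ bad mu by exists m.
case: (ex_minnP exmu) => mu notbad_mu mu_min.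
have mu0 : (0 < mu)%N.
  rewrite lt0n; apply: contraNneq la_v => mu0; apply/eqP.
  by have := badPn _ notbad_mu v; rewrite mu0 subr0; apply.
have mum : (mu <= m)%N by apply: mu_min.
have la_ge p x : (mu <= p)%N -> x \in Ug (a' - p%:Z) -> la (iter p l x) = 0.
  move=> lep xU; rewrite -(subnKC lep) iterD; apply: (badPn _ notbad_mu).
  by have := iter_deg (p - mu) xU; congr (_ \in Ug _); lia.
(* Composing a functional with L acts on its coefficients by 1 plus the transpose of K. *)
pose Kt b c := K c b.
pose f s := iter s (lop (U := k^o) idfun Kt).
have [be [be0 beP1 beP2]] := @underdetermined_system k J (iter t (lop (U := k^o) idfun Kt)) _ _ (lt mu (introT andP (conj mu0 mum))).
pose lav z x := if z is Posz p then la (iter p l x) else 0.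
have lav_lin z c x y : lav z (c *: x + y) = c *: lav z x + lav z y.
  by case: z => p /=; rewrite ?linearP // scaler0 addr0.
have fS s b : f s.+1 be b = f s be b + \sum_c K c b * f s be c.
  by rewrite /f /= lopE.
have f_low s b : deg b < r0 - s%:Z -> f s be b = 0.
  elim: s b => [|s IHs] b ltb; first by apply: beP1; rewrite /= /r0 /a' in ltb *; lia.
  rewrite fS IHs ?add0r; last by lia.
  apply: big1 => c _; have [->|/Kdeg dbc] := eqVneq (K c b) 0; first by rewrite mul0r.
  by rewrite IHs ?mulr0 //; lia.
pose La s (w : {ffun J -> U}) : k := \sum_b f s be b * lav (deg b - r0 + s%:Z) (w b).
have LaS s w : La s (lop l K w) = La s.+1 w.
  have lav_sum z (g : J -> k) : lav z (\sum_c g c *: w c) = \sum_c g c * lav z (w c).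
    have lav0 : lav z 0 = 0 by have := lav_lin z (-1) 0 0; rewrite scaler0 addr0 scaleN1r addNr.
    have lavD x y : lav z (x + y) = lav z x + lav z y.
      by have := lav_lin z 1 x y; rewrite !scale1r.
    rewrite (big_morph (lav z) lavD lav0); apply: eq_bigr => c _.
    by have := lav_lin z (g c) (w c) 0; rewrite lav0 !addr0.
  have lavD z x y : lav z (x + y) = lav z x + lav z y.
    by have := lav_lin z 1 x y; rewrite !scale1r.
  rewrite /La; under eq_bigr do rewrite lopE lavD lav_sum mulrDr mulr_sumr.
  rewrite big_split exchange_big -big_split /=; apply: eq_bigr => b _.
  rewrite fS mulrDl mulr_suml; congr (_ + _).
    have [zge|zlt] := leP (r0 - s%:Z) (deg b); last by rewrite f_low // !mul0r.
    congr (_ * _); rewrite (_ : deg b - r0 + s.+1%:Z = deg b - r0 + s%:Z + 1); last by lia.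
    have : 0 <= deg b - r0 + s%:Z by lia.
    by case: (deg b - r0 + s%:Z) => // p _; rewrite -PoszD addn1 /lav -iterSr.
  apply: eq_bigr => c _.
  have [->|/Kdeg dcb] := eqVneq (K c b) 0; first by rewrite !mul0r mulr0.
  rewrite mulrA [f _ _ _ * _]mulrC; congr (_ * lav _ _); lia.
have La_iter s w : La 0%N (iter s (lop l K) w) = La s w.
  have H s' : La s' (iter s (lop l K) w) = La (s + s')%N w.
    by elim: s s' => //= s IHs s'; rewrite LaS IHs addnS.
  by rewrite H addn0.
have La_image w : tot_deg Ug deg (i + t%:Z) w -> La 0%N w = 0.
  move=> /surjL[w' w'i ->]; rewrite La_iter; apply: big1 => b _.
  case E : (deg b - r0 + t%:Z) => [p|p]; last by rewrite mulr0.
  have [ltp|gep] := ltnP p mu.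
    by rewrite beP2 ?mul0r //= ; rewrite /r0 /a' in E; lia.
  rewrite /= la_ge ?mulr0 //.
  by have := w'i b; congr (_ \in Ug _); rewrite -E /r0; lia.
case/eqP: be0; apply/ffunP => b; rewrite [RHS]ffunE.
case Pb : (i + t%:Z - a - m%:Z - 1 < deg b <= i + t%:Z - a - m%:Z + mu%:Z - 1); last first.
  by apply: beP1; rewrite /= Pb.
case E : (deg b - r0) => [p|p]; last by rewrite /r0 /a' in E; lia.
have /badP[x xU lax] : bad p.
  by apply: contraT => /mu_min; rewrite /r0 /a' in E; lia.
pose w : {ffun J -> U} := [ffun c => if c == b then x else 0].
have : La 0%N w = 0.
  apply: La_image => c; rewrite ffunE; case: eqP => [->|_]; last by rewrite mem0v.
  by move: xU; congr (_ \in Ug _); rewrite /r0 in E; lia.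
rewrite /La (bigD1 b) //= big1 ?addr0 => [|c cb]; last first.
  rewrite ffunE (negPf cb); have := lav_lin (deg c - r0) (-1) 0 0.
  by rewrite scaler0 !addr0 scaleN1r addNr => ->; rewrite mulr0.
rewrite E /= ffunE eqxx => /eqP; rewrite mulf_eq0 (negPf lax) orbF => /eqP.
by [].
Qed.

End Counting.

(** * Pencils of linear maps *)

Section Generic.

Variable (k : fieldType).

Definition generic (S : k -> Prop) : Prop :=
  exists2 p : {poly k}, p != 0 & forall t, p.[t] != 0 -> S t.

Lemma genericI S1 S2 : generic S1 -> generic S2 -> generic (fun t => S1 t /\ S2 t).
Proof.
move=> [p p0 pS] [q q0 qS]; exists (p * q) => [|t]; first by rewrite mulf_neq0.
by rewrite hornerM mulf_eq0 negb_or => /andP[pt qt]; split; [exact: pS | exact: qS].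
Qed.

Lemma generic_forall_lt (S : nat -> k -> Prop) M :
  (forall i, generic (S i)) -> generic (fun t => forall i, (i < M)%N -> S i t).
Proof.
move=> gS; elim: M => [|M IH]; first by exists 1; rewrite ?oner_eq0.
have [p p0 pS] := genericI IH (gS M); exists p => // t /pS[St SMt] i.
by rewrite ltnS leq_eqVlt => /orP[/eqP->|/St].
Qed.

(** Substituting 1 - X is an involution, so it cannot annihilate the polynomial. It allows a pencil
    of two forms to be parametrized from either end. *)
Lemma generic_opp1 S : generic S -> generic (fun t => S (1 - t)).
Proof.
move=> [p p0 pS]; exists (p \Po (1 - 'X)) => [|t].
  apply: contraNneq p0 => pq; have : (p \Po (1 - 'X)) \Po (1 - 'X) = 0.
    by rewrite pq comp_poly0.
  rewrite -comp_polyA linearB /= comp_polyX (_ : 1 \Po _ = 1); last first.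
    by rewrite -[1]/(1%:P) comp_polyC.
  by rewrite subKr comp_polyXr => ->.
by rewrite horner_comp !hornerE; apply: pS.
Qed.

Lemma generic_ex S : [pchar k] =i pred0 -> generic S -> exists t, S t.
Proof.
move=> k0 [p p0 pS]; pose s := [seq (i%:R : k) | i <- iota 0 (size p)].
have us : uniq s.
  rewrite map_inj_uniq ?iota_uniq // => i j /eqP.
  wlog le : i j / (i <= j)%N => [H|].
    by have [/H//|/ltnW/H H'] := leqP i j; rewrite eq_sym => /H' ->.
  by rewrite eq_sym -subr_eq0 -natrB // pmulrn pchar0_intr_eq0 // => /eqP; lia.
have /allPn[t _ pt] : ~~ all (root p) s.
  apply/negP => /(fun r => max_poly_roots p0 r us).
  by rewrite size_map size_iota ltnn.
by exists t; apply: pS.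
Qed.

End Generic.

Section Pencil.

Variables (k : fieldType) (V : vectType k).

(** det (1 + t K) is a polynomial in t with value 1 at t = 0. *)
Lemma generic_unipotent (K : 'End(V)) :
  generic (fun t => forall v, v + t *: K v = 0 -> v = 0).
Proof.
pose X := vbasis {:V}; pose m := \dim {:V}.
pose M : 'M[k]_m := \matrix_(i, j) coord X j (K X`_i).
pose P : 'M[{poly k}]_m := 1%:M + 'X *: map_mx polyC M.
have Pt t : (\det P).[t] = \det (1%:M + t *: M).
  rewrite -[LHS]/(horner_eval t (\det P)) -det_map_mx; congr (\det _); apply/matrixP => i j.
  rewrite !mxE rmorphD rmorphM rmorph_nat /= /horner_eval hornerX hornerC.
  by [].
exists (\det P) => [|t].
  by apply/eqP => /(congr1 (fun p => p.[0])); rewrite Pt scale0r addr0 det1 horner0 => /eqP; rewrite oner_eq0.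
rewrite Pt => dt v v0.
pose c : 'rV[k]_m := \row_i coord X i v.
have cM : c *m (1%:M + t *: M) = 0.
  rewrite mulmxDr mulmx1 -scalemxAr; apply/rowP => j; rewrite !mxE.
  have := congr1 (coord X j) v0; rewrite linearD linearZ linear0 /= => vj0; rewrite -[RHS]vj0.
  congr (_ + _ * _); rewrite [v](coord_vbasis (memvf v)) !linear_sum.
  by apply: eq_bigr => i _; rewrite !mxE !linearZ.
have c0 : c = 0.
  have uM : 1%:M + t *: M \in unitmx by rewrite unitmxE unitfE.
  by rewrite -[c]mulmx1 -(mulmxV uM) mulmxA cM mul0mx.
rewrite [v](coord_vbasis (memvf v)) big1 // => i _.
by move/rowP: c0 => /(_ i); rewrite !mxE => ->; rewrite scale0r.
Qed.

Lemma section_ex (f : 'End(V)) (U : {vspace V}) :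
  exists h : 'End(V), (forall v, h v \in U) /\ (forall w, w \in (f @: U)%VS -> f (h w) = w).
Proof.
pose g := (f \o projv U)%VF; exists (projv U \o g^-1)%VF.
split=> [v|_ /memv_imgP[u uU ->]]; first by rewrite comp_lfunE memv_proj.
have -> : f u = g u by rewrite comp_lfunE projv_id.
have {2}<- : g (g^-1%VF (g u)) = g u by apply: limg_lfunVK; apply: memv_img (memvf u).
by rewrite !comp_lfunE.
Qed.

(** With h a left inverse of f on U, h (f + t g) is 1 + t h g on U. *)
Lemma pencil_inj (f g : 'End(V)) (U : {vspace V}) :
  (forall u, u \in U -> f u = 0 -> u = 0) ->
  generic (fun t => forall u, u \in U -> f u + t *: g u = 0 -> u = 0).
Proof.
move=> injf; have [h [hU fh]] := section_ex f U.
have hf u : u \in U -> h (f u) = u.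
  move=> uU; apply/eqP; rewrite -subr_eq0; apply/eqP/injf; first by rewrite rpredB.
  by rewrite linearB /= fh ?subrr // memv_img.
have [p p0 pS] := generic_unipotent (h \o g)%VF; exists p => // t pt u uU fg0.
apply: (pS t pt); rewrite comp_lfunE -{1}(hf u uU) -linearZ -linearD /=.
by rewrite fg0 linear0.
Qed.

(** With h a right inverse of f over W, (f + t g) h = 1 + t g h maps W to itself, for generic t
    injectively and hence onto W. *)
Lemma pencil_surj (f g : 'End(V)) (U W : {vspace V}) :
  (f @: U)%VS = W -> (g @: U <= W)%VS ->
  generic (fun t => ((f + t *: g) @: U)%VS = W).
Proof.
move=> fUW gUW; have [h [hU fh]] := section_ex f U; rewrite fUW in fh.
have [p p0 pS] := generic_unipotent (g \o h)%VF; exists p => // t pt.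
have fgW : ((f + t *: g) @: U <= W)%VS.
  apply/subvP => _ /memv_imgP[u uU ->]; rewrite add_lfunE scale_lfunE rpredD //.
    by rewrite -fUW memv_img.
  by rewrite memvZ // (subvP gUW) // memv_img.
apply/eqP; rewrite eqEsubv fgW /=.
pose phi := (\1 + t *: (g \o h))%VF.
have phiE w : w \in W -> phi w = (f + t *: g)%VF (h w).
  by move=> wW; rewrite !add_lfunE !scale_lfunE id_lfunE comp_lfunE fh.
have phiW : (phi @: W <= (f + t *: g) @: U)%VS.
  by apply/subvP => _ /memv_imgP[w wW ->]; rewrite phiE // memv_img.
apply: subv_trans phiW; rewrite -(geq_leqif (dimv_leqif_sup _)); last first.
  apply/subvP => _ /memv_imgP[w wW ->]; rewrite phiE //.
  by apply: (subvP fgW); rewrite memv_img.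
rewrite limg_dim_eq //; apply/eqP; rewrite -subv0; apply/subvP => w.
rewrite memv_cap memv_ker memv0 => /andP[_ /eqP pw]; apply/eqP/(pS t pt).
by move: pw; rewrite !add_lfunE scale_lfunE id_lfunE.
Qed.

End Pencil.

Section GradedPencil.

Variables (k : fieldType) (A : gradedAlg k).

Lemma gcomp_eventually0 : exists M, forall i, (M <= i)%N -> gcomp A i = 0%VS.
Proof.
have [N HN] := gcomp_full A; exists N => i Ni.
have le1 := sum_dim_gcomp A i.+1.
have le2 : (\dim {:A} <= \sum_(j < N) \dim (gcomp A j))%N.
  by rewrite -HN; apply: dimv_leq_sum.
apply/eqP; rewrite -dimv_eq0.
move: le1; rewrite big_ord_recr /= -(big_mkord predT (fun j => \dim (gcomp A j))).
rewrite (big_cat_nat (n := N)) //= big_mkord.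
by move: le2; set x := \dim _; set y := (\sum_(j < N) _)%N; set z := (\sum_(N <= j < i) _)%N; lia.
Qed.

(** Each degree imposes one generic condition on t, and only finitely many degrees are nonzero. *)
Lemma generic_WLP (z0 z1 : A) : z0 \in gcomp A 1 -> z1 \in gcomp A 1 ->
  (forall i, mul_full_rank z0 i 1) ->
  generic (fun t => forall i, mul_full_rank (z0 + t *: z1) i 1).
Proof.
move=> z0_1 z1_1 fr; have [M HM] := gcomp_eventually0.
have gen i : generic (fun t => mul_full_rank (z0 + t *: z1) i 1).
  case: (fr i) => H.
    have [|p p0 pS] := @pencil_inj k A (amull z0) (amull z1) (gcomp A i).
      move=> u ui; rewrite lfunE /= => zu0; apply: H; rewrite ?mem0v //.
      by rewrite expr1 mulr0.
    exists p => // t /pS inj; left => x y xi yi; rewrite expr1 => /eqP.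
    rewrite -subr_eq0 -mulrBr => /eqP xy; apply/eqP; rewrite -subr_eq0; apply/eqP.
    apply: inj; first by rewrite rpredB.
    by rewrite !lfunE /= -xy mulrDl scalerAl.
  have [||p p0 pS] := @pencil_surj k A (amull z0) (amull z1) (gcomp A i) (gcomp A (i + 1)).
  - by rewrite -H expr1.
  - apply/subvP => _ /memv_imgP[u ui ->]; rewrite lfunE /= addnC.
    by apply: (subvP (gcompM A 1 i)); rewrite memv_mul.
  exists p => // t /pS imS; right; rewrite expr1 -[RHS]imS; congr (_ @: _)%VS.
  by apply/lfunP => x; rewrite add_lfunE scale_lfunE !lfunE /= mulrDl scalerAl.
have [p p0 pS] := generic_forall_lt M gen; exists p => // t /pS St i.
have [/St//|Mi] := ltnP i M; left => x y; rewrite HM // !memv0 => /eqP -> /eqP -> //.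
Qed.

End GradedPencil.

(** * Rank conditions and Hilbert functions *)

Section RankDimension.

Variables (k : fieldType) (U : vectType k) (Ug : int -> {vspace U}).
Variable (l : {linear U -> U}).
Hypothesis lU : forall a v, v \in Ug a -> l v \in Ug (a + 1).

Let im a m := (linfun (iter m l) @: Ug a)%VS.

Lemma im_sub a m : (im a m <= Ug (a + m%:Z))%VS.
Proof.
apply/subvP => _ /memv_imgP[u ua ->]; rewrite lfunE /=; exact: iter_deg.
Qed.

Lemma inj_at_dim a m : inj_at Ug l a m -> (\dim (Ug a) = \dim (im a m))%N.
Proof.
move=> inj; rewrite /im limg_dim_eq //; apply/eqP; rewrite -subv0; apply/subvP => w.
by rewrite memv_cap memv_ker memv0 lfunE => /andP[wa /eqP /(inj _ wa) ->].
Qed.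

Lemma surj_at_im a m : surj_at Ug l a m <-> im a m = Ug (a + m%:Z).
Proof.
split=> [surj|imE v].
  apply/eqP; rewrite eqEsubv im_sub /=; apply/subvP => v /surj[u ua ->].
  by rewrite -[iter m l u](lfunE (iter m l)) memv_img.
by rewrite -imE => /memv_imgP[u ua ->]; exists u; rewrite ?lfunE.
Qed.

Lemma inj_at_le a m : inj_at Ug l a m -> (\dim (Ug a) <= \dim (Ug (a + m%:Z)))%N.
Proof. by move/inj_at_dim->; apply: dimvS (im_sub a m). Qed.

Lemma surj_at_ge a m : surj_at Ug l a m -> (\dim (Ug (a + m%:Z)) <= \dim (Ug a))%N.
Proof.
by move/surj_at_im <-; have := limg_ker_dim (linfun (iter m l)) (Ug a); rewrite -/(im a m); lia.
Qed.

Lemma inj_surj_at a m : inj_at Ug l a m ->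
  (\dim (Ug (a + m%:Z)) <= \dim (Ug a))%N -> surj_at Ug l a m.
Proof.
move=> inj le; apply/surj_at_im/eqP.
by rewrite -(geq_leqif (dimv_leqif_eq (im_sub a m))) -(inj_at_dim inj).
Qed.

Lemma surj_inj_at a m : surj_at Ug l a m ->
  (\dim (Ug a) <= \dim (Ug (a + m%:Z)))%N -> inj_at Ug l a m.
Proof.
move=> /surj_at_im imE le v va lv0.
have := limg_ker_dim (linfun (iter m l)) (Ug a); rewrite -/(im a m) imE => dimE.
have /eqP : \dim (Ug a :&: lker (linfun (iter m l))) = 0%N by lia.
rewrite dimv_eq0 => /eqP capE; apply/eqP; rewrite -memv0 -capE memv_cap va.
by rewrite memv_ker lfunE /= lv0.
Qed.

End RankDimension.

Section CenteredRank.

Variables (k : fieldType) (A : gradedAlg k) (D : nat).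
Hypothesis D_socle : socle_degree A D.

Local Notation gzA := (gz A).

Lemma gz_high a : D%:Z < a -> gzA a = 0%VS.
Proof. by case: a => //= i Di; case: D_socle => _; apply; lia. Qed.

Lemma gz_low a : a < 0 -> gzA a = 0%VS.
Proof. by case: a. Qed.

Lemma mul_full_rank_at (l : A) (i t : nat) : l \in gcomp A 1 ->
  mul_full_rank l i t <->
  inj_at gzA (amull l) i%:Z t \/ surj_at gzA (amull l) i%:Z t.
Proof.
move=> l1; have itE x : iter t (amull l) x = l ^+ t * x.
  by elim: t => [|t IH]; rewrite ?expr0 ?mul1r //= lfunE /= IH exprS mulrA.
split=> -[H|H]; [left|right|left|right].
- by move=> v vi; rewrite itE => lv0; apply: H; rewrite ?mem0v // mulr0.
- move=> v; rewrite -PoszD /= -H => /memv_imgP[u ui ->].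
  by exists u; rewrite // lfunE itE.
- move=> x y xi yi; rewrite -!itE => /eqP; rewrite -subr_eq0 -linearB => /eqP /H.
  by move=> /(_ (rpredB xi yi))/eqP; rewrite subr_eq0 => /eqP.
apply/eqP; rewrite eqEsubv; apply/andP; split; apply/subvP => v.
  move=> /memv_imgP[u ui ->]; rewrite lfunE /= -itE.
  by have := iter_deg (gz_mul l1) t (ui : u \in gzA i%:Z); rewrite -PoszD.
move=> vit; have [u ui ->] := H v vit.
by rewrite itE; apply/memv_imgP; exists u; rewrite // lfunE.
Qed.

Definition rank_centered (l : A) : Prop :=
  forall e, inj_sum gzA (amull l) e \/ surj_sum gzA (amull l) e.

Lemma inj_sum_low l e : e < 0 -> inj_sum gzA (amull l) e.
Proof.
move=> e0 a m am v; rewrite gz_low ?memv0 => [/eqP -> //|]; lia.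
Qed.

Lemma surj_sum_high l e : 2 * D%:Z < e -> surj_sum gzA (amull l) e.
Proof.
move=> eD a m am v; rewrite gz_high ?memv0 => [/eqP ->|]; last by lia.
by exists 0; rewrite ?mem0v ?linear0.
Qed.

Lemma rank_centered_SLP l : l \in gcomp A 1 -> rank_centered l -> SLP A.
Proof.
move=> l1 Q; exists l => // i t t0; apply/mul_full_rank_at => //.
by case: (Q (2 * i%:Z + t%:Z)) => H; [left | right]; apply: H.
Qed.

Definition sum_centered (h : int -> nat) : Prop := forall e,
  (forall i j, i < j -> i + j = e -> (h i <= h j)%N) \/
  (forall i j, i < j -> i + j = e -> (h j <= h i)%N).

Lemma rank_sum_centered l e : l \in gcomp A 1 ->
  (inj_sum gzA (amull l) e ->
     forall i j, i < j -> i + j = e -> (hilb A i <= hilb A j)%N) /\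
  (surj_sum gzA (amull l) e ->
     forall i j, i < j -> i + j = e -> (hilb A j <= hilb A i)%N).
Proof.
move=> l1; split=> H i j ij ije; rewrite !hilb_gz.
  have /inj_at_le : inj_at gzA (amull l) i (absz (j - i)) by apply: H; lia.
  by move/(_ (gz_mul l1)); rewrite (_ : i + _ = j) //; lia.
have /surj_at_ge : surj_at gzA (amull l) i (absz (j - i)) by apply: H; lia.
by move/(_ (gz_mul l1)); rewrite (_ : i + _ = j) //; lia.
Qed.

(** Almost centeredness propagates a strict comparison outward along its antidiagonal. An opposite
    strict comparison further inside would propagate outward too and contradict the first, so each
    antidiagonal has one direction. *)
Lemma sum_almost_centered : sum_centered (hilb A) <-> almost_centered A.
Proof.
split=> [H|[H1 H2] e].
  split=> i j ij hij s; case: (H (i + j)) => Hs.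
  - by apply: Hs; lia.
  - by have := Hs i j ij erefl; lia.
  - by have := Hs i j ij erefl; lia.
  - by apply: Hs; lia.
have [[i [j [ij ije hij]]]|none] : (exists i j, [/\ i < j, i + j = e & (hilb A i < hilb A j)%N]) \/
    (forall i j, i < j -> i + j = e -> (hilb A j <= hilb A i)%N).
(* Testing j from 0 to D suffices, since h_i < h_j forces h_j to be nonzero. *)
- have [/hasP[j _ /andP[ij hij]]|/hasPn no] := boolP (has (fun j : nat =>
     (e - j%:Z < j%:Z) && (hilb A (e - j%:Z) < hilb A j%:Z)%N) (iota 0 D.+1)).
    by left; exists (e - j%:Z), j%:Z; split=> //; lia.
  right=> i j ij ije; rewrite leqNgt; apply/negP => hij.
  case: j ij ije hij => // j ij ije hij.
  have [jD|jD] := leqP j D; last by move: hij; rewrite !hilb_gz [gz A j]gz_high ?dimv0 //; lia.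
  have /no : j \in iota 0 D.+1 by rewrite mem_iota.
  by rewrite (_ : e - j%:Z = i) ?ij ?hij //; lia.
- left=> i' j' i'j' i'j'e; rewrite leqNgt; apply/negP => lt.
  have [le|gt] := leP i' i.
    have [di dj] : i - (absz (i - i'))%:Z = i' /\ j + (absz (i - i'))%:Z = j' by lia.
    by have := H1 i j ij hij (absz (i - i')); rewrite di dj leqNgt lt.
  have [di dj] : i' - (absz (i' - i))%:Z = i /\ j' + (absz (i' - i))%:Z = j by lia.
  by have := H2 i' j' i'j' lt (absz (i' - i)); rewrite di dj leqNgt hij.
by right.
Qed.

Lemma hilb_high a : D%:Z < a -> hilb A a = 0%N.
Proof. by move=> Da; rewrite hilb_gz gz_high ?dimv0. Qed.

Lemma hilb_low a : a < 0 -> hilb A a = 0%N.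
Proof. by case: a. Qed.

Lemma hilb0_gt0 : (0 < hilb A 0)%N.
Proof.
rewrite lt0n dimv_eq0; apply: contraTneq (gcomp1 A) => ->.
by rewrite memv0 oner_eq0.
Qed.

Lemma hilbD_gt0 : (0 < hilb A D)%N.
Proof. by rewrite lt0n dimv_eq0; case: D_socle. Qed.

Definition interlaced (h : int -> nat) : Prop :=
  forall i : nat, (i <= D./2)%N -> (h (i%:Z - 1)%R <= h (D%:Z - i%:Z)%R <= h i%:Z)%N.

Definition interlaced_rev (h : int -> nat) : Prop :=
  forall i : nat, (i <= D./2)%N -> (h (D%:Z - i%:Z + 1)%R <= h i%:Z <= h (D%:Z - i%:Z)%R)%N.

(** The pairs (-1, D) and (0, D + 1) force the directions on the antidiagonals D - 1 and D + 1; the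
    direction on D decides which chain holds. *)
Lemma sum_centered_interlaced : sum_centered (hilb A) ->
  interlaced (hilb A) \/ interlaced_rev (hilb A).
Proof.
move=> Q; have h0 := hilb0_gt0; have hD := hilbD_gt0.
have hN : hilb A (-1) = 0%N by [].
have hD1 : hilb A (D%:Z + 1) = 0%N by apply: hilb_high; lia.
have up i j : i < j -> i + j = D%:Z - 1 -> (hilb A i <= hilb A j)%N.
  case: (Q (D%:Z - 1)) => H; first exact: H.
  have : (hilb A D <= hilb A (-1)%R)%N by apply: H; lia.
  by rewrite hN leqNgt hD.
have down i j : i < j -> i + j = D%:Z + 1 -> (hilb A j <= hilb A i)%N.
  case: (Q (D%:Z + 1)) => H; last exact: H.
  have : (hilb A 0 <= hilb A (D%:Z + 1)%R)%N by apply: H; lia.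
  by rewrite hD1 leqNgt h0.
case: (Q D%:Z) => H; [right | left] => i iD.
  rewrite down ?andTb; [|lia|lia].
  have [->|ne] := eqVneq (D%:Z - i%:Z) i%:Z; first exact: leqnn.
  by apply: H; lia.
rewrite up ?andTb; [|lia|lia].
have [->|ne] := eqVneq (D%:Z - i%:Z) i%:Z; first exact: leqnn.
by apply: H; lia.
Qed.

Lemma interlaced_sum_centered h :
  (forall a, a < 0 -> h a = 0%N) -> (forall a, D%:Z < a -> h a = 0%N) ->
  interlaced h ->
  (forall i j, i < j -> i + j < D%:Z -> (h i <= h j)%N) /\
  (forall i j, i < j -> D%:Z <= i + j -> (h j <= h i)%N).
Proof.
move=> hlow hhigh H.
(* By hypothesis h increases along the sequence D, 0, D - 1, 1, D - 2, 2, ... *)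
pose rk (a : int) : int := if 2 * a < D%:Z then 2 * a + 1 else 2 * (D%:Z - a).
pose ev (n : nat) : int := if odd n then (n./2)%:Z else D%:Z - (n./2)%:Z.
have evS n : (n < D)%N -> (h (ev n) <= h (ev n.+1))%N.
  move=> nD; rewrite /ev /=; have := odd_double_half n.
  have [no|ne] := boolP (odd n) => /= nE.
    by have /andP[+ _] := H n./2.+1 ltac:(lia); rewrite uphalfE /=; congr (h _ <= h _)%N; lia.
  by have /andP[_] := H n./2 ltac:(lia); congr (h _ <= h _)%N; lia.
have ev_mono n m : (n <= m)%N -> (m <= D)%N -> (h (ev n) <= h (ev m))%N.
  move=> nm; rewrite -(subnKC nm); elim: (m - n)%N => [|p IH] le; first by rewrite addn0.
  by apply: leq_trans (IH _) _; [lia | rewrite addnS; apply: evS; lia].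
have evK (a : int) : 0 <= a <= D%:Z -> 0 <= rk a <= D%:Z /\ ev (absz (rk a)) = a.
  rewrite /rk; case: ifP => aD a0; split; [lia| |lia|].
    have -> : absz (2 * a + 1)%R = ((absz a).*2).+1 by lia.
    by rewrite /ev /= odd_double /= uphalf_double; lia.
  have -> : absz (2 * (D%:Z - a))%R = ((absz (D%:Z - a)%R).*2) by lia.
  by rewrite /ev odd_double /= doubleK; lia.
have mono a b : 0 <= a <= D%:Z -> 0 <= b <= D%:Z -> rk a <= rk b -> (h a <= h b)%N.
  move=> /evK[ra ea] /evK[rb eb] rab; rewrite -ea -eb; apply: ev_mono; lia.
split=> i j ij ijD.
  have [i0|i0] := ltP i 0; first by rewrite hlow.
  by apply: mono; [lia | lia | rewrite /rk; case: ifP; case: ifP; lia].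
have [jD|jD] := ltP D%:Z j; first by rewrite hhigh.
by apply: mono; [lia | lia | rewrite /rk; case: ifP; case: ifP; lia].
Qed.

(** The second chain becomes the first for the reflected function h (D - a). *)
Lemma interlaced_or_sum_centered :
  interlaced (hilb A) \/ interlaced_rev (hilb A) -> sum_centered (hilb A).
Proof.
move=> [H|H] e.
  have [up down] := interlaced_sum_centered hilb_low hilb_high H.
  have [eD|eD] := ltP e D%:Z; [left | right] => i j ij ije.
    by apply: up; rewrite // ije.
  by apply: down; rewrite // ije.
pose h a := hilb A (D%:Z - a).
have hlow (a : int) : a < 0 -> h a = 0%N by move=> a0; apply: hilb_high; lia.
have hhigh (a : int) : D%:Z < a -> h a = 0%N by move=> a0; apply: hilb_low; lia.
have DK (a : int) : D%:Z - (D%:Z - a) = a by lia.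
have [|up down] := interlaced_sum_centered hlow hhigh.
  move=> i iD; rewrite /h; have := H i iD; rewrite DK.
  by rewrite (_ : D%:Z - (i%:Z - 1) = D%:Z - i%:Z + 1); last by lia.
have [eD|eD] := ltP D%:Z e; [right | left] => i j ij ije.
  have := up (D%:Z - j) (D%:Z - i); rewrite /h !DK; apply; lia.
have := down (D%:Z - j) (D%:Z - i); rewrite /h !DK; apply; lia.
Qed.

(** A map of full rank is injective or surjective according to the dimensions, so on each
    antidiagonal all powers of l follow the direction of the Hilbert function. *)
Lemma SLP_rank_centered : SLP A -> sum_centered (hilb A) ->
  exists2 l, l \in gcomp A 1 & rank_centered l.
Proof.
move=> [l l1 fr] Q; exists l => // e.
have at_or a (m : nat) : inj_at gzA (amull l) a m \/ surj_at gzA (amull l) a m.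
  case: m => [|m]; first by left => v _ /= ->.
  case: a => a; last by left => v; rewrite memv0 => /eqP ->.
  by apply/mul_full_rank_at => //; apply: fr.
have le_inj a (m : nat) : (hilb A a <= hilb A (a + m%:Z))%N -> inj_at gzA (amull l) a m.
  by rewrite !hilb_gz => le; case: (at_or a m) => // /(surj_inj_at (gz_mul l1)); apply.
have ge_surj a (m : nat) : (hilb A (a + m%:Z) <= hilb A a)%N -> surj_at gzA (amull l) a m.
  by rewrite !hilb_gz => ge; case: (at_or a m) => // /(inj_surj_at (gz_mul l1)); apply.
case: (Q e) => H; [left | right] => a [|m] ae.
- by apply: le_inj; rewrite addr0.
- by apply: le_inj; apply: H; lia.
- by apply: ge_surj; rewrite addr0.
by apply: ge_surj; apply: H; lia.
Qed.

End CenteredRank.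

(** * Tensor products with monomial complete intersections *)

Lemma rank_centered_tensor_SLP (k : fieldType) (A : gradedAlg k) l :
  [pchar k] =i pred0 -> l \in gcomp A 1 -> rank_centered l ->
  forall n (d : 'I_n -> nat) (d_gt0 : forall i, (0 < d i)%N),
    SLP (tensor A (monomial_ci k d_gt0)).
Proof.
move=> k0 l1 Q n d d_gt0; exists (tform l (mci_ell k d_gt0)).
  by apply: tform_comp => //; apply: mci_ell_comp.
move=> i t t0; apply/full_rankP => //; first exact: mci_ell_comp.
exact: (lefschetz_power k0 (gz_mul l1) (sl2_mci k d_gt0) Q).
Qed.

(** * Recovering a rank-centered form from factors k[x]/(x^d) *)

Section OneVariable.

Variable d : nat.

Local Notation box := {dffun forall i : 'I_1, 'I_d}.

Lemma sum_ord_interval (x y : int) (m : nat) :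
  (\sum_(s < m) (x < s%:Z <= y)%R)%N%:Z
    = Num.max 0 (Num.min y (m%:Z - 1) - Num.max x (- 1)) :> int.
Proof.
elim: m => [|m IH]; first by rewrite big_ord0; lia.
rewrite big_ord_recr PoszD IH /=.
by have [] := boolP (x < m%:Z <= y); rewrite /=; lia.
Qed.

Lemma deg_count1 (x y : int) :
  (deg_count (@box_deg 1 (fun=> d)) x y)%:Z
    = Num.max 0 (Num.min y (d%:Z - 1) - Num.max x (- 1)) :> int.
Proof.
rewrite -sum_ord_interval; congr Posz.
rewrite /deg_count -sum1_card big_mkcond /=.
pose f (s : 'I_d) : box := [ffun _ => s].
have f_bij : bijective f.
  exists (fun b : box => b ord0) => [s|b]; first by rewrite ffunE.
  by apply/ffunP => i; rewrite ffunE (ord1 i).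
rewrite (reindex f) /=; last exact: onW_bij.
apply: eq_bigr => s _; rewrite inE /= /box_deg mdegE big_ord1 mnmE ffunE.
by case: (x < s%:Z <= y).
Qed.

End OneVariable.

(** The counts are lengths of intervals cut off at 0 and d - 1. With 2i + t = e + d - 1, i - a is m
    / 2 rounded down whenever 2a + m = e, and the windows of mu <= m degrees compare strictly as
    [count_inj] and [count_surj] require. *)
Lemma SLP_truncated_rank_centered (k : fieldType) (A : gradedAlg k) (D : nat) :
  socle_degree A D -> (forall a, a \in gcomp A 0 -> exists c, a = c *: 1) ->
  (forall (d : nat) (d_gt0 : (1 <= d)%N), SLP (tensor A (truncated_poly k d_gt0))) ->
  exists2 l, l \in gcomp A 1 & rank_centered l.
Proof.
move=> D_socle A0 slp.
(* In the cases that remain m <= 2D, so with this d each window meets at most one end of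
   [0, d - 1]. *)
have [d d_gt0 dE] : exists2 d, (0 < d)%N & d = (2 * D + 2)%N by exists (2 * D + 2)%N; lia.
have [z z1 fr] := slp d d_gt0.
have [l [u [l1 u1 zE]]] := tform_ex A0 z1.
exists l => // e.
have [e0|e0] := ltP e 0; first by left; apply: inj_sum_low.
have [eD|eD] := ltP (2 * D%:Z) e; first by right; apply: (surj_sum_high D_socle).
(* The parity of e decides between t = d and t = d - 1. *)
have [i [t [t0 it]]] : exists i t : nat, (1 <= t)%N /\ 2 * i%:Z + t%:Z = e + d%:Z - 1 /\ (d - 1 <= t <= d)%N.
  case: e e0 eD => // e _ eD; have := odd_double_half e.
  have [oe|ee] := boolP (odd e) => /= eE.
    by exists e./2, d; split; [|split]; lia.
  by exists e./2, d.-1; split; [|split]; lia.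
have Kdeg := fun b c => @mul_kernel_deg k 1 (fun=> d) (fun=> d_gt0) u b c u1.
have := fr i t t0; rewrite zE => /(full_rankP _ _ l1 u1)[H|H]; [left | right] => a m am.
  have [a0|a0] := ltP a 0; first by move=> v; rewrite gz_low // memv0 => /eqP ->.
  apply: (count_inj (gz_mul l1) Kdeg H) => mu /andP[mu0 mum].
  by rewrite -ltz_nat !deg_count1; lia.
have [aD|aD] := ltP D%:Z (a + m%:Z).
  move=> v; rewrite (gz_high D_socle aD) memv0 => /eqP ->.
  by exists 0; rewrite ?mem0v ?linear0.
apply: (count_surj (gz_mul l1) Kdeg H) => mu /andP[mu0 mum].
by rewrite -ltz_nat !deg_count1; lia.
Qed.

(** * Recovering a rank-centered form from square-free factors *)

Section SquareFree.

Variable n : nat.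

Local Notation box := {dffun forall i : 'I_n, 'I_2}.
Local Notation count := (deg_count (@box_deg n (fun=> 2))).

Lemma deg_count_split (x y : int) : x < y -> count x y = (count x (x + 1) + count (x + 1) y)%N.
Proof.
move=> xy; rewrite /deg_count -!sum1_card [LHS](bigID [pred b | box_deg b <= x + 1]) /=.
by congr (_ + _)%N; apply: eq_bigl => b; rewrite !inE /=; lia.
Qed.

Lemma deg_count_binomial (r : nat) : count (r%:Z - 1) r%:Z = 'C(n, r).
Proof.
rewrite -[n in RHS]card_ord -card_draws.
pose f (S : {set 'I_n}) : box := [ffun i => inord (i \in S)].
pose g (b : box) : {set 'I_n} := [set i | b i == 1%N :> nat].
have fK : cancel f g.
  move=> S; apply/setP => i; rewrite !inE ffunE inordK; last by case: (i \in S).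
  by case: (i \in S).
have gK : cancel g f.
  move=> b; apply/ffunP => i; apply: val_inj; rewrite ffunE inE.
  by rewrite /= inordK; [case: (b i) => -[|[|]] | case: eqP].
have deg_f S : box_deg (f S) = #|S|%:Z.
  rewrite /box_deg mdegE -sum1_card [in RHS]big_mkcond /=; congr Posz.
  by apply: eq_bigr => i _; rewrite mnmE ffunE inordK; case: (i \in S).
rewrite /deg_count -!sum1_card (reindex f) /=; last by exists g => x _.
apply: eq_bigl => S; rewrite !inE deg_f; move: #|_| => c. by apply/idP/eqP; lia.
Qed.

Lemma deg_count_neg (r : int) : r < 0 -> count (r - 1) r = 0%N.
Proof.
by move=> r0; apply: eq_card0 => b; rewrite !inE /= /box_deg; lia.
Qed.

End SquareFree.

Lemma bin_lt_half n r s : (r < s)%N -> (s.*2 <= n)%N -> ('C(n, r) < 'C(n, s))%N.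
Proof.
have step j : (j.*2.+2 <= n)%N -> ('C(n, j) < 'C(n, j.+1))%N.
  move=> jn; have := mul_bin_left n j; have : (0 < 'C(n, j))%N by rewrite bin_gt0; lia.
  nia.
elim: s => // s IHs; rewrite ltnS leq_eqVlt => /orP[/eqP <- | rs] sn.
  by apply: step; lia.
by apply: ltn_trans (IHs rs _) (step s _); lia.
Qed.

Lemma bin_lt n r s : (s <= n)%N ->
  (`|2 * s%:Z - n%:Z| < `|2 * r%:Z - n%:Z|)%R -> ('C(n, r) < 'C(n, s))%N.
Proof.
move=> sn; have [rn|nr] := leqP r n; last by move=> _; rewrite bin_small // bin_gt0.
pose refl j := if (j.*2 <= n)%N then j else (n - j)%N.
have reflE j : (j <= n)%N -> 'C(n, j) = 'C(n, refl j).
  by rewrite /refl; case: ifP => // _ /bin_sub ->.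
move=> lt; rewrite (reflE r rn) (reflE s sn); apply: bin_lt_half.
  by rewrite /refl; case: ifP; case: ifP; lia.
by rewrite /refl; case: ifP; lia.
Qed.

Lemma deg_count_lt n (p q : int) : 0 <= p <= n%:Z ->
  `|2 * p - n%:Z| < `|2 * q - n%:Z| ->
  (deg_count (@box_deg n (fun=> 2)) (q - 1)%R q < deg_count (@box_deg n (fun=> 2)) (p - 1)%R p)%N.
Proof.
case: p => // p pn; rewrite deg_count_binomial; case: q => q lt.
  by rewrite deg_count_binomial; apply: bin_lt.
by rewrite deg_count_neg // bin_gt0; lia.
Qed.

(** Both sides count the degrees in (x, y + 1]. Comparing a window with its shift by one is thus
    comparing two binomial coefficients. *)
Lemma deg_count_shift n (x y : int) : x < y ->
  (deg_count (@box_deg n (fun=> 2)) (x + 1)%R (y + 1)%R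
     + deg_count (@box_deg n (fun=> 2)) (x + 1 - 1)%R (x + 1)%R
   = deg_count (@box_deg n (fun=> 2)) x y
     + deg_count (@box_deg n (fun=> 2)) (y + 1 - 1)%R (y + 1)%R)%N.
Proof.
move=> xy; rewrite !addrK addnC -deg_count_split; last by lia.
rewrite /deg_count -!sum1_card [LHS](bigID [pred b | box_deg b <= y]) /=.
by congr (_ + _)%N; apply: eq_bigl => b; rewrite !inE /=; move: (box_deg b) => c; lia.
Qed.

Lemma deg_count_shift_lt n (x1 y1 x2 y2 : int) : x1 < y1 -> x2 = x1 + 1 -> y2 = y1 + 1 ->
  0 <= x2 <= n%:Z -> `|2 * x2 - n%:Z| < `|2 * y2 - n%:Z| ->
  (deg_count (@box_deg n (fun=> 2)) x2 y2 < deg_count (@box_deg n (fun=> 2)) x1 y1)%N.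
Proof.
move=> xy -> -> x2n /(deg_count_lt x2n) lt; have := deg_count_shift n xy.
move: lt; do 4!move: (deg_count _ _ _) => ?; lia.
Qed.

Lemma deg_count_shift_gt n (x1 y1 x2 y2 : int) : x1 < y1 -> x2 = x1 + 1 -> y2 = y1 + 1 ->
  0 <= y2 <= n%:Z -> `|2 * y2 - n%:Z| < `|2 * x2 - n%:Z| ->
  (deg_count (@box_deg n (fun=> 2)) x1 y1 < deg_count (@box_deg n (fun=> 2)) x2 y2)%N.
Proof.
move=> xy -> -> y2n /(deg_count_lt y2n) lt; have := deg_count_shift n xy.
move: lt; do 4!move: (deg_count _ _ _) => ?; lia.
Qed.

(** With 2i = e + n - 1, shifting the window of mu <= m degrees by one exchanges two degrees whose
    doubled distances from n / 2 are |m + 1 - 2 mu| and m + 1, so the binomial coefficients compare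
    strictly. *)
Lemma WLP_squarefree_sum (k : fieldType) (A : gradedAlg k) (D n : nat) l
    (u : monomial_ci k (n := n) (d := fun=> 2%N) (fun=> isT)) (e : int) :
  socle_degree A D -> l \in gcomp A 1 -> u \in gcomp _ 1 ->
  (2 * D + 2 <= n)%N -> (exists i : nat, 2 * i%:Z = e + n%:Z - 1) ->
  (forall i, mul_full_rank (A := tensor A (squarefree_alg k n)) (tform l u) i 1) ->
  inj_sum (gz A) (amull l) e \/ surj_sum (gz A) (amull l) e.
Proof.
move=> D_socle l1 u1 nD [i ie] fr.
have [e0|e0] := ltP e 0; first by left; apply: inj_sum_low.
have [eD|eD] := ltP (2 * D%:Z) e; first by right; apply: (surj_sum_high D_socle).
have Kdeg := fun b c => @mul_kernel_deg k n (fun=> 2%N) (fun=> isT) u b c u1.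
have := fr i; move/(full_rankP _ _ l1 u1) => [H|H]; [left | right] => a m am.
  have [a0|a0] := ltP a 0; first by move=> v; rewrite gz_low // memv0 => /eqP ->.
  apply: (count_inj (gz_mul l1) Kdeg H) => mu /andP[mu0 mum].
  by apply: deg_count_shift_lt; lia.
have [aD|aD] := ltP D%:Z (a + m%:Z).
  move=> v; rewrite (gz_high D_socle aD) memv0 => /eqP ->.
  by exists 0; rewrite ?mem0v ?linear0.
apply: (count_surj (gz_mul l1) Kdeg H) => mu /andP[mu0 mum].
by apply: deg_count_shift_gt; lia.
Qed.

(** n = 2D + 2 handles the odd e with a form l0, and n = 2D + 3 the even e with a form l1. Only the
    A-part of each Lefschetz element is perturbed, until the two A-parts agree. *)
Lemma WLP_squarefree_rank_centered (k : fieldType) (A : gradedAlg k) (D : nat) :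
  [pchar k] =i pred0 -> socle_degree A D ->
  (forall a, a \in gcomp A 0 -> exists c, a = c *: 1) ->
  (forall n, WLP (tensor A (squarefree_alg k n))) ->
  exists2 l, l \in gcomp A 1 & rank_centered l.
Proof.
move=> k0 D_socle A0 wlp.
have [z0 z0_1 fr0] := wlp (2 * D + 2)%N; have [z1 z1_1 fr1] := wlp (2 * D + 3)%N.
have [l0 [u0 [l0_1 u0_1 z0E]]] := tform_ex A0 z0_1.
have [l1 [u1 [l1_1 u1_1 z1E]]] := tform_ex A0 z1_1.
have mix_1 n (a : A) : a \in gcomp A 1 -> tens a 1 \in gcomp (tensor A (squarefree_alg k n)) 1.
  by move=> a1; apply: (mem_tensor_comp a1 (gcomp1 _)).
have gen0 := generic_WLP z0_1 (mix_1 _ _ (rpredB l1_1 l0_1)) fr0.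
have gen1 := generic_WLP z1_1 (mix_1 _ _ (rpredB l0_1 l1_1)) fr1.
(* The common form l0 + s (l1 - l0) is l1 + (1 - s)(l0 - l1), so the second pencil is taken at 1 -
   s. *)
have [s [fr0s fr1s]] := generic_ex k0 (genericI gen0 (generic_opp1 gen1)).
have tformZ n (l l' : A) (u : squarefree_alg k n) c :
    tform (l + c *: l') u = tform l u + c *: tens l' 1.
  by rewrite /tform [l + _]addrC tensP -addrA addrC.
exists (l0 + s *: (l1 - l0)); first by rewrite rpredD ?memvZ ?rpredB.
move=> e; have [e0|e0] := ltP e 0; first by left; apply: inj_sum_low.
case: e e0 => // e _; have := odd_double_half e; have [oe|ee] := boolP (odd e) => eE.
  apply: (@WLP_squarefree_sum k A D _ _ u0) => //.
  - by rewrite rpredD ?memvZ ?rpredB.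
  - by exists (D + 1 + e./2)%N; lia.
  by move=> i; rewrite tformZ -z0E.
have -> : l0 + s *: (l1 - l0) = l1 + (1 - s) *: (l0 - l1).
  by rewrite scalerBl scale1r addrA subrKC -[l0 - l1]opprB scalerN opprK.
apply: (@WLP_squarefree_sum k A D _ _ u1) => //.
- by rewrite rpredD ?memvZ ?rpredB.
- by lia.
- by exists (D + 1 + e./2)%N; lia.
by move=> i; rewrite tformZ -z1E.
Qed.

Theorem theorem5p9 (k : fieldType) (k_char0 : [pchar k] =i pred0)
    (A : gradedAlg k) (A_std : standard_graded A)
    (D : nat) (D_socle : socle_degree A D) :
  [<-> (* (a) *)
       almost_centered A /\ SLP A;
       (* (b) *)
       SLP A /\
         ((forall i : nat, (i <= D./2)%N ->
             (hilb A (i%:Z - 1) <= hilb A (D%:Z - i%:Z) <= hilb A i%:Z)%N) \/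
          (forall i : nat, (i <= D./2)%N ->
             (hilb A (D%:Z - i%:Z + 1) <= hilb A i%:Z <= hilb A (D%:Z - i%:Z))%N));
       (* (c) *)
       forall (d : nat) (d_gt0 : (1 <= d)%N),
         SLP (tensor A (truncated_poly k d_gt0));
       (* (d) *)
       forall (n : nat) (d : 'I_n -> nat) (d_gt0 : forall i, (1 <= d i)%N),
         (1 <= n)%N -> SLP (tensor A (monomial_ci k d_gt0));
       (* (e) *)
       forall n : nat, WLP (tensor A (squarefree_alg k n))].
Proof.
have A0 a : a \in gcomp A 0 -> exists c, a = c *: 1.
  by case: A_std => m [rho [_ _ ->]]; apply: image_comp0.
have centered_tensor l : l \in gcomp A 1 -> rank_centered l ->
    forall n (d : 'I_n -> nat) (d_gt0 : forall i, (1 <= d i)%N),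
    SLP (tensor A (monomial_ci k d_gt0)).
  exact: rank_centered_tensor_SLP.
tfae.
- move=> [ac slp]; split=> //.
  exact: (sum_centered_interlaced D_socle ((sum_almost_centered D_socle).2 ac)).
- move=> [slp ineq] d d_gt0.
  have [l l1 Q] := SLP_rank_centered slp (interlaced_or_sum_centered D_socle ineq).
  exact: centered_tensor l l1 Q _ _ _.
- move=> slp n d d_gt0 _.
  have [l l1 Q] := SLP_truncated_rank_centered D_socle A0 slp.
  exact: centered_tensor l l1 Q _ _ _.
- move=> slp n.
  (* (d) speaks of n >= 1 only, while (e) includes n = 0. Its one-variable instances already produce
     a centered form, which serves every n. *)
  have [|l l1 Q] := SLP_truncated_rank_centered D_socle A0; first by move=> d d_gt0; apply: slp.
  have [z z1 fr] := centered_tensor l l1 Q n (fun=> 2%N) (fun=> isT).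
  by exists z => // i; apply: fr.
move=> wlp; have [l l1 Q] := WLP_squarefree_rank_centered k_char0 D_socle A0 wlp.
split; last exact: rank_centered_SLP l1 Q.
apply/(sum_almost_centered D_socle) => e; have [inj surj] := rank_sum_centered e l1.
by case: (Q e) => [/inj|/surj]; [left | right].
Qed.
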